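(* Let $R$ be a countable relational structure which is prehomogeneous and such that $\mathrm{Aut}(R)$ is oligomorphic. If $R$ has an infinite monomorphic component $A$ which is not a strongly indiscernible subset of $R$, then $R$ has $2^{\aleph_0}$ siblings (up to isomorphism).
   Context: A relational structure with domain $E$ is $R=(E,(\rho_i)_{i\in I})$ with $\rho_i\subseteq E^{n_i}$. For $A\subseteq E$, $R_{\restriction A}=(A,(A^{n_i}\cap\rho_i)_{i\in I})$. A local isomorphism of $R$ is an isomorphism from a restriction $R_{\restriction F}$ onto a restriction $R_{\restriction F'}$. A structure $S$ embeds into $R$ if $S$ is isomorphic to a restriction of $R$. A sibling of $R$ is a structure $S$ such that $S$ embeds into $R$ and $R$ embeds into $S$. $R$ is prehomogeneous if for every finite $F\subseteq E$ there is a finite $F'$ with $F\subseteq F'\subseteq E$ such that every local isomorphism of $R$ with domain $F$ extends to an automorphism of $R$ provided that it extends to a local isomorphism with domain $F'$. A permutation group on $E$ is oligomorphic if for every integer $n$ it has finitely many orbits on $n$-element subsets of $E$. A subset $E'\subseteq E$ is a monomorphic part of $R$ if for every integer $k$ and every pair $A,A'$ of $k$-element subsets of $E$ with $A\setminus E'=A'\setminus E'$, the structures $R_{\restriction A}$ and $R_{\restriction A'}$ are isomorphic. A monomorphic component is a monomorphic part maximal for inclusion; the monomorphic components form a partition of $E$. A subset $E'\subseteq E$ is strongly indiscernible if for every integer $k$ and every pair $A,A'$ of $k$-element subsets of $E'$, every bijection from $A$ to $A'$, extended by the identity on $E\setminus E'$, is a local isomorphism of $R$; this amounts to saying that every permutation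 of $E'$, extended by the identity on $E\setminus E'$, is an automorphism of $R$. *)

(* Defs.v *)
From mathcomp Require Import all_boot.
From mathcomp Require Import boolp classical_sets functions cardinality.

Set Implicit Arguments.
Unset Strict Implicit.
Unset Printing Implicit Defensive.

Local Open Scope classical_set_scope.
Local Open Scope card_scope.

(* Relational structures of signature [ar], where [ar i] is the arity of the
   i-th relation; the n-tuples of elements of E are the maps from 'I_n to E. *)
Record structure (I : Type) (ar : I -> nat) := Structure {
  domain :> Type;
  rel_of : forall i : I, set ('I_(ar i) -> domain) }.

Arguments rel_of {I ar} _ i _.

Section RelationalStructures.
Context {I : Type} {ar : I -> nat}.
Implicit Types R S : structure ar.

(* The domain is convertible to [set_type A]; unfolding the latter keeps the
   universe of domains below that of [set], which is needed in order to form
   sets of structures. *)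
Definition restriction R (A : set R) : structure ar :=
  @Structure I ar {x : R | x \in A} (fun i => [set t | rel_of R i (fun k => sval (t k))]).

Definition isomorphism R S (f : R -> S) : Prop :=
  bijective f /\
  forall (i : I) (t : 'I_(ar i) -> R), rel_of R i t <-> rel_of S i (f \o t).

Definition isomorphic R S : Prop := exists f : R -> S, isomorphism f.

Definition embeds S R : Prop := exists A : set R, isomorphic S (restriction A).

Definition sibling R S : Prop := embeds S R /\ embeds R S.

Definition sibling_classes R : set (set (structure ar)) :=
  (fun S => [set T | isomorphic S T]) @` [set S | sibling R S].

(* A partial map of domain F is represented by a total map f on R, of which
   only the values on F matter. *)
Definition local_isomorphism R (F F' : set R) (f : R -> R) : Prop :=
  exists g : restriction F -> restriction F',
    isomorphism g /\ forall x : restriction F, sval (g x) = f (sval x).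

Definition prehomogeneous R : Prop :=
  forall F : set R, finite_set F ->
  exists F' : set R, [/\ finite_set F', F `<=` F' &
    forall (G : set R) (f : R -> R), local_isomorphism F G f ->
      (exists (G' : set R) (f' : R -> R),
         local_isomorphism F' G' f' /\ {in F, f' =1 f}) ->
      exists g : R -> R, isomorphism g /\ {in F, g =1 f}].

Definition monomorphic_part R (E' : set R) : Prop :=
  forall (k : nat) (A A' : set R), A #= `I_k -> A' #= `I_k ->
    A `\` E' = A' `\` E' -> isomorphic (restriction A) (restriction A').

Definition monomorphic_component R (A : set R) : Prop :=
  monomorphic_part A /\
  forall B : set R, monomorphic_part B -> A `<=` B -> B = A.

Definition strongly_indiscernible R (E' : set R) : Prop :=
  forall (k : nat) (A A' : set R), A `<=` E' -> A' `<=` E' ->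
    A #= `I_k -> A' #= `I_k ->
    forall f : R -> R, set_bij A A' f -> {in ~` E', f =1 id} ->
    local_isomorphism (A `|` ~` E') (A' `|` ~` E') f.

End RelationalStructures.

Definition Aut {I : Type} {ar : I -> nat} (R : structure ar) : set (R -> R) :=
  [set f | isomorphism f].

Arguments Aut {I ar} R _.

(* Each orbit of G on the n-element subsets of E is a set of subsets of E. *)
Definition oligomorphic (E : Type) (G : set (E -> E)) : Prop :=
  forall n : nat,
    finite_set ((fun X : set E => [set g @` X | g in G]) @`
                  [set X : set E | X #= `I_n]).

(* Main.v *)
Require Import Defs.
From mathcomp Require Import all_boot.
From mathcomp Require Import boolp classical_sets functions cardinality.
From mathcomp Require Import filter finmap.
From mathcomp Require Import order ssralg ssrnum ssrint rat.

Set Implicit Arguments.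
Unset Strict Implicit.
Unset Printing Implicit Defensive.

Local Open Scope classical_set_scope.
Local Open Scope card_scope.

(** Call two elements x and y interchangeable ([sim]) when, for every finite H
    that contains neither of them, adding x to H or adding y to H gives
    isomorphic restrictions.  This is an equivalence relation, it speaks of
    isomorphism only, and an infinite monomorphic component A is one of its
    classes.

    The component carries a linear order such that every increasing partial
    map of A, extended by the identity outside A, preserves the relations
    ([component_order]).  Let D be a finite set disjoint from A.  There are
    finitely many orbits of tuples, so Ramsey's theorem gives, for each k, a
    k-element K0 in A whose increasing maps are induced by automorphisms that
    fix D.  For another k-element K in A, monomorphy gives an isomorphism from
    D + K to D + K0.  It may move D, but once D and K contain witnesses that no
    element of D is interchangeable with those of A, it must send D to D and K
    to K0, and the order of K0 can be pulled back to K.  A free ultrafilter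
    glues the orders of the finite parts.

    Suppose now that A is not strongly indiscernible.  Adjacent transpositions
    generate all permutations, so some adjacent transposition is not a local
    isomorphism; hence, as soon as p elements lie on both sides, an element
    cannot jump over another one ([not_strongly_indiscernible_no_jump]).
    Consequently the number of elements between x and y is the least number of
    elements to be removed before x can be replaced by y ([removes]).  This
    number is invariant under automorphisms, so by oligomorphy it takes
    finitely many values.  Finite intervals of A are therefore bounded, long
    intervals can be cut for ever, and A contains every countable order
    ([component_contains_countable_orders]).

    Take in A a copy of the rationals times the naturals, ordered
    lexicographically, and keep the whole complement of A together with w q
    points above each rational q ([thinned]).  The countable order A embeds in
    what was kept of it, so this restriction is a sibling of R.  Say that x and
    y are [adjacent] when y can replace x after removing finitely many
    interchangeable elements.  Inside A the classes are the fibres, of size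
    w q; outside A they are the same as in R, and their finite sizes are
    bounded because there are finitely many orbits of points.  The sizes above
    that bound can be prescribed at will, and distinct sets of sizes give
    nonisomorphic siblings.  Conversely a sibling is determined by the subset
    of R onto which it embeds, so there are no more than continuum many. *)

(** * Isomorphisms and partial embeddings *)

Lemma inj_surj_bijective (T U : Type) (f : T -> U) :
  injective f -> (forall y, exists x, f x = y) -> bijective f.
Proof.
by move=> fi /choice[g gK]; exists g => // x; apply: fi; rewrite gK.
Qed.

Section Isomorphism.
Context {I : Type} {ar : I -> nat}.
Implicit Types R S T : structure ar.

Lemma isomorphic_refl S : isomorphic S S.
Proof. by exists id; split => //; exists id. Qed.

Lemma isomorphic_sym S T : isomorphic S T -> isomorphic T S.
Proof.
move=> [f [[g fK gK] fR]]; exists g; split; first by exists f.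
move=> i t; rewrite (fR i (g \o t)).
by have -> : f \o (g \o t) = t by apply/funext => k /=; rewrite gK.
Qed.

Lemma isomorphic_trans S T R :
  isomorphic S T -> isomorphic T R -> isomorphic S R.
Proof.
move=> [f [fb fR]] [g [gb gR]]; exists (g \o f); split; first exact: bij_comp.
by move=> i t; rewrite fR gR.
Qed.

End Isomorphism.

Section Embeddings.
Context {I : Type} {ar : I -> nat} {R : structure ar}.
Implicit Types (A B M N K H : set R) (f g : R -> R) (x y z : R).

(** Local isomorphisms with domain M, as total functions whose values outside
    M are irrelevant; the relations are not cut down to subtypes, which makes
    composition and restriction painless. *)
Definition emb M f : Prop :=
  (forall x y, M x -> M y -> f x = f y -> x = y) /\
  forall (i : I) (t : 'I_(ar i) -> R), (forall k, M (t k)) ->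
    (rel_of R i t <-> rel_of R i (f \o t)).

Lemma emb_eq M f g : (forall x, M x -> f x = g x) -> emb M f -> emb M g.
Proof.
move=> fg [fi fR]; split=> [x y Mx My|i t Mt]; first by rewrite -!fg//; exact: fi.
rewrite (fR i t Mt).
by have -> : f \o t = g \o t by apply/funext => k /=; exact: fg.
Qed.

Lemma emb_sub M N f : N `<=` M -> emb M f -> emb N f.
Proof.
move=> NM [fi fR]; split=> [x y /NM Mx /NM My|i t Nt]; first exact: fi.
by apply: fR => k; apply: NM.
Qed.

Lemma emb_id M : emb M id.
Proof. by split. Qed.

Lemma emb_comp M N f g :
  emb M f -> emb N g -> (forall x, M x -> N (f x)) -> emb M (g \o f).
Proof.
move=> [fi fR] [gi gR] MN; split=> [x y Mx My /= gf|i t Mt].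
  by apply: fi => //; apply: gi gf; exact: MN.
by rewrite (fR i t Mt) (gR i (f \o t))// => k; apply: MN.
Qed.

(** An embedding reflects the property of being an embedding.  This replaces
    the construction of inverse maps: to see that f is one, it suffices to
    recognise g o f. *)
Lemma emb_cancel M N f g :
  emb N g -> (forall x, M x -> N (f x)) -> emb M (g \o f) -> emb M f.
Proof.
move=> [gi gR] MN [fi fR]; split=> [x y Mx My fxy|i t Mt].
  by apply: fi => //=; rewrite fxy.
by rewrite (fR i t Mt) (gR i (f \o t))// => k; apply: MN.
Qed.

Lemma emb_inv M f : emb M f ->
  exists2 g, emb (f @` M) g & forall x, M x -> g (f x) = x.
Proof.
move=> [fi fR].
have [g gP] : exists g : R -> R, forall y, (f @` M) y -> M (g y) /\ f (g y) = y.
  suff /choice[g gP] : forall y, exists z, (f @` M) y -> M z /\ f z = y.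
    by exists g.
  move=> y; have [[x Mx <-]|nMy] := pselect ((f @` M) y); first by exists x.
  by exists y => /nMy.
have gf x : M x -> g (f x) = x.
  by move=> Mx; have [] := gP (f x); [exists x | move=> Mg; exact: fi].
exists g => //; split=> [y z fy fz gyz|i t Mt].
  by have [_ <-] := gP y fy; have [_ <-] := gP z fz; rewrite gyz.
rewrite (fR i (g \o t)); last by move=> k; have [] := gP _ (Mt k).
have -> // : f \o (g \o t) = t.
by apply/funext => k /=; have [] := gP _ (Mt k).
Qed.

(** Relations have finite arity, so each tuple lives on a finite set. *)
Lemma emb_finitary M f :
  (forall K, finite_set K -> K `<=` M -> emb K f) -> emb M f.
Proof.
move=> fK; split=> [x y Mx My|i t Mt].
  have [||fi _] := fK [set x; y]; first exact: finite_set2.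
    by move=> z [->|->].
  by apply: fi; [left|right].
have [||_] := fK (range t).
- exact: finite_image.
- by move=> _ [k _ <-].
- by apply=> k; exists k.
Qed.

Lemma emb_aut M g : Aut R g -> emb M g.
Proof.
by move=> [/bij_inj gi gR]; split=> [x y _ _ /gi//|i t _]; exact: gR.
Qed.

Lemma aut_inv g : Aut R g -> exists2 g', Aut R g' & cancel g g'.
Proof.
move=> [[g' gK g'K] gR]; exists g' => //; split; first by exists g.
move=> i t; rewrite (gR i (g' \o t)).
by have -> : g \o (g' \o t) = t by apply/funext => k /=; rewrite g'K.
Qed.

Lemma aut_comp f g : Aut R f -> Aut R g -> Aut R (g \o f).
Proof.
by move=> [fb fR] [gb gR]; split=> [|i t]; [exact: bij_comp|rewrite fR gR].
Qed.

Definition iso A B : Prop := exists2 f, emb A f & f @` A = B.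

Lemma iso_refl A : iso A A.
Proof. by exists id; [exact: emb_id|exact: image_id]. Qed.

Lemma iso_sym A B : iso A B -> iso B A.
Proof.
move=> [f fe <-]; have [g ge gf] := emb_inv fe; exists g => //.
rewrite eqEsubset; split=> [_ [_ [x Ax <-] <-]|x Ax]; first by rewrite gf.
by exists (f x); [exists x|exact: gf].
Qed.

Lemma iso_trans A B C : iso A B -> iso B C -> iso A C.
Proof.
move=> [f fe <-] [g ge <-]; exists (g \o f); last by rewrite image_comp.
by apply: emb_comp fe ge _ => x Ax; exists x.
Qed.

Lemma iso_emb A f : emb A f -> iso A (f @` A).
Proof. by exists f. Qed.

Lemma iso_card A B : iso A B -> B #= A.
Proof.
move=> [f [fi _] <-]; apply: inj_card_eq => x y /set_mem Ax /set_mem; exact: fi.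
Qed.

Lemma emb_local_isomorphism A B f :
  emb A f -> f @` A = B -> local_isomorphism A B f.
Proof.
move=> fe fAB.
have fB (u : restriction A) : f (sval u) \in B.
  by apply/mem_set; rewrite -fAB; exists (sval u) => //; apply/set_mem; case: u.
exists (fun u => exist _ (f (sval u)) (fB u)); split=> //; split.
  apply: inj_surj_bijective => [[x xA] [y yA] e|[y yB]].
    apply: val_inj => /=; move: e => /(congr1 sval)/=.
    by case: fe => fi _; apply: fi; exact: set_mem.
  have [x /mem_set xA fxy] : (f @` A) y by rewrite fAB; exact: set_mem.
  by exists (exist _ x xA) => //; apply: val_inj.
move=> i u; case: fe => _ fR /=.
by rewrite (fR i (fun k => sval (u k)))// => k; apply: set_mem; case: (u k).
Qed.

(** A map between subtypes is extended to the whole domain by the identity. *)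
Lemma restriction_isoP A B :
  isomorphic (restriction A) (restriction B) <-> iso A B.
Proof.
split=> [[g [[g' gK g'K] gR]]|[f fe fAB]]; last first.
  by have [g [giso _]] := emb_local_isomorphism fe fAB; exists g.
pose f x := if pselect (x \in A) is left h then sval (g (exist _ x h)) else x.
have fg (u : restriction A) : f (sval u) = sval (g u).
  case: u => x xA; rewrite /f /=; case: pselect => [h|/(_ xA)//].
  by congr (sval (g _)); exact: val_inj.
have fgx x (xA : x \in A) : f x = sval (g (exist _ x xA)) by rewrite -fg.
exists f.
  split=> [x y /mem_set xA /mem_set yA|i t At].
    rewrite (fgx x xA) (fgx y yA) => /val_inj/(can_inj gK) e.
    by have := congr1 sval e.
  have At' k : t k \in A by exact: mem_set.
  pose u k : restriction A := exist _ (t k) (At' k).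
  rewrite (_ : f \o t = fun k => sval ((g \o u) k)); first exact: (gR i u).
  by apply/funext => k /=; rewrite -fg.
rewrite eqEsubset; split=> [_ [x /mem_set xA <-]|y /mem_set yB].
  by rewrite (fgx x xA); apply/set_mem; case: (g _).
exists (sval (g' (exist _ y yB))); first by apply/set_mem; case: (g' _).
by rewrite fg g'K.
Qed.

End Embeddings.

(** * Interchangeable elements and monomorphic components *)
Lemma card_setU1 (T : Type) (H : set T) x n :
  ~ H x -> H #= `I_n -> x |` H #= `I_n.+1.
Proof.
move=> nHx Hn; apply/eq_cardSP; exists x; first by left.
by rewrite setDUl setDv set0U not_setD1.
Qed.

Lemma card_setD1 (T : Type) (X : set T) x n :
  X x -> X #= `I_n.+1 -> X `\ x #= `I_n.
Proof.
move=> Xx Xn; have Xf : finite_set X by apply/finite_setP; exists n.+1.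
have [m Xm] := (finite_setP (X `\ x)).1 (finite_setD _ Xf).
suff -> : n = m by [].
have XSm : X #= `I_m.+1.
  by rewrite -(setD1K Xx); apply: card_setU1 => // -[_ /(_ erefl)].
by move: XSm; rewrite (card_eql Xn) => /card_eq_II[].
Qed.

Lemma setD1_sub (T : Type) (A : set T) x : A x -> [set x] `\` A = set0.
Proof. by move=> Ax; rewrite setD_eq0 => _ ->. Qed.

Lemma infinite_avoid (T : Type) (A K : set T) :
  infinite_set A -> finite_set K -> exists2 a, A a & ~ K a.
Proof.
move=> Ainf Kfin; have /infinite_setN0[a []] := infinite_setD Ainf Kfin.
by exists a.
Qed.

Section Similarity.
Context {I : Type} {ar : I -> nat} {R : structure ar}.
Implicit Types (A B M N K H : set R) (f g : R -> R) (x y z : R).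

(** The relation is relative to a set M of allowed contexts, since it is used
    in R, in finite restrictions of R and in the siblings built from R. *)
Definition sim M x y : Prop :=
  forall H, finite_set H -> H `<=` M -> ~ H x -> ~ H y -> iso (x |` H) (y |` H).

Lemma sim_sub M N x y : N `<=` M -> sim M x y -> sim N x y.
Proof. by move=> NM s H Hf HN; apply: s => // z /HN/NM. Qed.

Lemma sim_refl M x : sim M x x.
Proof. by move=> H _ _ _ _; exact: iso_refl. Qed.

Lemma sim_sym M x y : sim M x y -> sim M y x.
Proof. by move=> s H Hf HM Hy Hx; apply/iso_sym/s. Qed.

(** The only delicate case is a context H that contains the middle element y:
    writing H = K + y, one passes from K + y + x to K + y + z, and then from
    K + z + x to K + z + y. *)
Lemma sim_trans M x y z : M x -> M z -> sim M x y -> sim M y z -> sim M x z.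
Proof.
move=> Mx Mz sxy syz H Hf HM nHx nHz.
have [Hy|nHy] := pselect (H y); last exact: iso_trans (sxy H _ _ _ _) (syz H _ _ _ _).
have [->|xz] := pselect (x = z); first exact: iso_refl.
have xy : x <> y by move=> xy; apply: nHx; rewrite xy.
have zy : z <> y by move=> zy; apply: nHz; rewrite zy.
set K := H `\ y.
have KM : K `<=` M by move=> w [/HM].
have Kf : finite_set K by exact: finite_setD.
have HE : H = y |` K by rewrite setD1K.
have i1 : iso (y |` (x |` K)) (z |` (x |` K)).
  apply: syz.
  - by rewrite finite_setU; split=> //; exact: finite_set1.
  - by move=> w [->|/KM].
  - by move=> [/esym//|[_ /(_ erefl)]].
  - by move=> [/esym|[/nHz]].
have i2 : iso (x |` (z |` K)) (y |` (z |` K)).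
  apply: sxy.
  - by rewrite finite_setU; split=> //; exact: finite_set1.
  - by move=> w [->|/KM].
  - by move=> [|[/nHx]].
  - by move=> [/esym//|[_ /(_ erefl)]].
rewrite HE (setUCA [set x]) (setUCA [set z]); apply: iso_trans i1 _.
by rewrite (setUCA [set z]).
Qed.

(** Interchangeability is a statement about isomorphism types of finite sets,
    which an embedding preserves; it thus descends along embeddings. *)
Lemma sim_emb M N f x y : emb M f -> (forall z, M z -> N (f z)) ->
  M x -> M y -> sim N (f x) (f y) -> sim M x y.
Proof.
move=> fe fMN Mx My s H Hf HM nHx nHy.
have isof w : M w -> iso (w |` H) (f w |` (f @` H)).
  move=> Mw; rewrite -image_set1 -image_setU; apply/iso_emb.
  by apply: emb_sub fe => z [->|/HM].
have fH w : M w -> ~ H w -> ~ (f @` H) (f w).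
  move=> Mw nHw [z Hz fzw]; apply: nHw; case: fe => fi _.
  by rewrite -(fi z w)//; exact: HM.
apply: iso_trans (isof x Mx) _; apply: iso_trans (iso_sym (isof y My)).
apply: s; [exact: finite_image| |exact: fH|exact: fH].
by move=> _ [z /HM/fMN ? <-].
Qed.

Lemma monomorphic_part_iso A K K' : monomorphic_part A ->
  finite_set K -> K' #= K -> K `\` A = K' `\` A -> iso K K'.
Proof.
move=> Amono /finite_setP[k Kk] KK' KA; apply/restriction_isoP.
by apply: (Amono k) => //; apply: card_eq_trans KK' Kk.
Qed.

Lemma monomorphic_part_sim A x y :
  monomorphic_part A -> A x -> A y -> sim setT x y.
Proof.
move=> Amono Ax Ay H Hf _ nHx nHy; have [n Hn] := (finite_setP H).1 Hf.
have [xn yn] := (card_setU1 nHx Hn, card_setU1 nHy Hn).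
apply: (monomorphic_part_iso Amono).
- by apply/finite_setP; exists n.+1.
- by rewrite card_eq_sym in xn; exact: card_eq_trans yn xn.
- by rewrite !setDUl; congr (_ `|` _); rewrite [LHS]setD1_sub// setD1_sub.
Qed.

(** Adding to A an element y interchangeable with its elements keeps it
    monomorphic, because y can be traded for a fresh element of the infinite
    set A; maximality then puts y in A. *)
Lemma monomorphic_component_sim A x y : infinite_set A ->
  monomorphic_component A -> A x -> sim setT x y -> A y.
Proof.
move=> Ainf [Amono Amax] Ax sxy; apply: contrapT => nAy.
suff /Amax : monomorphic_part (A `|` [set y]).
  move=> /(_ (fun z Az => or_introl Az)) E; apply: nAy; rewrite -E.
  by right.
move=> k K K' Kk K'k KA.
have Kf : finite_set K by apply/finite_setP; exists k.
have K'f : finite_set K' by apply/finite_setP; exists k.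
have [||a Aa nKa] := @infinite_avoid _ A (K `|` K') => //.
  by rewrite finite_setU.
(* y, the only element on which K and K' may differ outside A, is replaced
   by the fresh element a *)
have repl H : finite_set H -> ~ H a ->
    exists2 H', iso H H' & H' `\` A = H `\` (A `|` [set y]).
  move=> Hf nHa; have [Hy|nHy] := pselect (H y); last first.
    exists H; first exact: iso_refl.
    rewrite eqEsubset; split=> z [Hz nAz]; split=> //; last first.
      by move=> Az; apply: nAz; left.
    by move=> [//|zy]; apply: nHy; rewrite -zy.
  exists (a |` H `\ y).
    rewrite -[X in iso X](setD1K Hy).
    have sya : sim setT y a.
      apply: (sim_trans _ _ (sim_sym sxy)) => //.
      exact: (monomorphic_part_sim Amono).
    apply: sya => //; first exact: finite_setD.
    - by move=> [_ /(_ erefl)].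
    - by move=> [].
  rewrite eqEsubset; split=> z.
    by move=> [[->//|[Hz zy]] nAz]; split=> // -[].
  move=> [Hz nAyz]; split; last by move=> Az; apply: nAyz; left.
  by right; split=> // zy; apply: nAyz; right.
have [||K1 KK1 K1A] := repl K => //; first by move=> Ka; apply: nKa; left.
have [||K2 KK2 K2A] := repl K' => //; first by move=> Ka; apply: nKa; right.
apply/restriction_isoP; apply: (iso_trans KK1); apply: iso_trans (iso_sym KK2).
have K1k := card_eq_trans (iso_card KK1) Kk.
have K2k := card_eq_trans (iso_card KK2) K'k.
apply: (monomorphic_part_iso Amono).
- by apply/finite_setP; exists k.
- by rewrite card_eq_sym in K1k; exact: card_eq_trans K2k K1k.
- by rewrite K1A KA K2A.
Qed.

End Similarity.

(** * Ramsey's theorem by ultrafilters *)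
Lemma free_ultrafilter (T : Type) (A : set T) : infinite_set A ->
  exists2 U : set_system T, UltraFilter U & forall B, finite_set (A `\` B) -> U B.
Proof.
move=> Ainf; suff FF : ProperFilter [set B | finite_set (A `\` B)].
  by have [U [UU FU]] := ultraFilterLemma FF; exists U.
split=> [|]; first by rewrite /= setD0.
split=> [|P Q /= Pf Qf|P Q PQ /=].
- by rewrite /= setDT.
- by rewrite setDIr finite_setU.
- by apply: sub_finite_set => x [Ax nQx]; split=> // /PQ.
Qed.

Lemma filter_finite (T D : Type) (F : set_system T) (X : set D)
    (P : D -> set T) {FF : Filter F} : finite_set X ->
  (forall d, X d -> F (P d)) -> F [set x | forall d, X d -> P d x].
Proof.
move=> /(@finite_fsetP {classic D})[Y ->] FP.
have := @filter_bigI T {classic D} Y P F FF FP.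
by apply: filterS => x Px d Yd; exact: Px.
Qed.

Lemma ultra_finite (T D : Type) (U : set_system T) (X : set D) (c : T -> D) :
  UltraFilter U -> finite_set X -> U (c @^-1` X) ->
  exists2 d, X d & U [set x | c x = d].
Proof.
move=> UU Xf UX; apply: contrapT => nU.
have UC d : X d -> U [set x | c x <> d].
  move=> Xd; have [Ud|//] := in_ultra_setVsetC [set x | c x = d] UU.
  by exfalso; apply: nU; exists d.
have [x [Xx /(_ _ Xx)]] := filter_ex (filterI UX (filter_finite Xf UC)).
exact.
Qed.

Lemma finite_seqs (T : eqType) (X : set T) n : finite_set X ->
  finite_set [set s : seq T | size s = n /\ forall x, x \in s -> X x].
Proof.
move=> Xf; elim: n => [|n IHn].
  by apply: sub_finite_set (finite_set1 [::]) => s [/size0nil].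
apply: sub_finite_set (finite_image2 cons Xf IHn) => -[|x s] [//= [sn] sX].
exists x; first by apply: sX; rewrite mem_head.
by exists s => //; split=> // y ys; apply: sX; rewrite inE ys orbT.
Qed.

Section Ramsey.
Context {T : eqType} {C : Type}.
Variables (A : set T) (c : seq T -> C) (n : nat).

Let over (s : seq T) : Prop := forall x, x \in s -> A x.

Let over_rcons s x : over s -> A x -> over (rcons s x).
Proof.
by move=> sA Ax y; rewrite mem_rcons inE => /predU1P[->|/sA].
Qed.

(** chi m s is the colour that c gives to s followed by m elements, each of
    them chosen generically for the ultrafilter U. *)
Let limit_color (U : set_system T) : UltraFilter U ->
  U A -> finite_set (c @` [set s | size s = n /\ over s]) ->
  exists chi : nat -> seq T -> C, chi 0 = c /\
    forall m s, size s + m.+1 = n -> over s ->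
      U [set x | chi m (rcons s x) = chi m.+1 s].
Proof.
move=> UU UA cf; have [x0 _] := filter_ex UA.
have /choice[lim limP] : forall f : T -> C, exists d,
    (exists d', U [set x | f x = d']) -> U [set x | f x = d].
  move=> f; have [[d Ud]|nU] := pselect (exists d', U [set x | f x = d']).
    by exists d.
  by exists (f x0) => /nU.
pose chi := fix chi m s :=
  if m is m'.+1 then lim (fun x => chi m' (rcons s x)) else c s.
exists chi; split=> // m s smn sA.
have chiD k : forall r, size r + k = n -> over r ->
    (c @` [set s | size s = n /\ over s]) (chi k r).
  elim: k => [|k IHk] r rk rA; first by exists r => //; split=> //; rewrite -rk addn0.
  have ch x : A x -> (c @` [set s | size s = n /\ over s]) (chi k (rcons r x)).
    by move=> Ax; apply: IHk; [rewrite size_rcons addSnnS|exact: over_rcons].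
  have [|d Dd Ud] := @ultra_finite _ _ _ _ (fun x => chi k (rcons r x)) UU cf.
    by apply: filterS UA => x; exact: ch.
  have : U [set x | chi k (rcons r x) = chi k.+1 r] by apply: limP; exists d.
  by move=> /(filterI Ud)/filter_ex[x [/= ud <-]]; rewrite ud.
have [|d _ Ud] := @ultra_finite _ _ _ _ (fun x => chi m (rcons s x)) UU cf.
  apply: filterS UA => x Ax; apply: chiD; last exact: over_rcons.
  by rewrite size_rcons addSnnS.
by apply: limP; exists d.
Qed.

(** The elements a 0, a 1, ... are chosen one after the other.  Each new one is
    generic over the tuples of the previous ones, which are finite in number,
    so it keeps the limit colour of every increasing tuple equal to the limit
    colour of the empty tuple. *)
Lemma ramsey N : infinite_set A ->
  finite_set (c @` [set s | size s = n /\ over s]) ->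
  exists a : nat -> T,
    [/\ forall i, i < N -> A (a i),
        forall i j, i < N -> j < N -> a i = a j -> i = j &
        exists c0, forall J : seq nat, size J = n -> sorted ltn J ->
          all (gtn N) J -> c (map a J) = c0].
Proof.
move=> Ainf cf; have [U UU UA] := free_ultrafilter Ainf.
have [|chi [chi0 chiS]] := limit_color UU _ cf.
  by apply: UA; rewrite setDv; exact: finite_set0.
suff [a [aA ai aJ]] : exists a : nat -> T,
    [/\ forall i, i < N -> A (a i),
        forall i j, i < N -> j < N -> a i = a j -> i = j &
        forall J : seq nat, size J <= n -> sorted ltn J ->
          all (gtn N) J -> chi (n - size J) (map a J) = chi n [::]].
  exists a; split=> //; exists (chi n [::]) => J Jn Js JN.
  by rewrite -chi0 -(aJ J) ?Jn ?subnn.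
elim: N => [|N [a [aA ai aJ]]].
  have [x0 Ax0] := infinite_setN0 Ainf.
  exists (fun=> x0); split=> // -[|//] _ _ _.
  by rewrite subn0.
pose X := \bigcup_(m in `I_n)
  [set J : seq nat | size J = m /\ forall i, i \in J -> `I_N i].
have Xf : finite_set X.
  by apply: bigcup_finite => // m _; apply: finite_seqs.
have UJ J : X J -> U [set x | chi (n - (size J).+1) (rcons (map a J) x) =
                              chi (n - size J) (map a J)].
  move=> [m /= mn [Jm JN]]; rewrite Jm -[n - m]subnSK//; apply: chiS.
    by rewrite size_map Jm subnSK// subnKC// ltnW.
  by move=> _ /mapP[i iJ ->]; apply: aA; exact: JN.
have Unew : U (~` (a @` `I_N)).
  by apply: UA; rewrite setDE setCK; apply: finite_setIr; exact: finite_image.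
have UAA : U A by apply: UA; rewrite setDv; exact: finite_set0.
have [x [[Ax xnew] xJ]] :=
  filter_ex (filterI (filterI UAA Unew) (filter_finite Xf UJ)).
exists (fun i => if i < N then a i else x); split.
- by move=> i _; case: ifP => // /aA.
- move=> i j; rewrite !ltnS => iN jN.
  case: (ltnP i N) => iN'; case: (ltnP j N) => jN'; first exact: ai.
  + by move=> aix; exfalso; apply: xnew; exists i.
  + by move=> ajx; exfalso; apply: xnew; exists j.
  + by move=> _; apply/eqP; rewrite eqn_leq (leq_trans iN jN') (leq_trans jN iN').
have mapa J : all (gtn N) J -> map (fun i => if i < N then a i else x) J = map a J.
  by move=> /allP JN; apply/eq_in_map => i /JN /= ->.
move=> J; case: (lastP J) => [|J' i] Jn Js JN; first by rewrite /= subn0.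
move: JN; rewrite all_rcons /= ltnS => /andP[iN _].
move: (Js); rewrite (sorted_pairwise ltn_trans) pairwise_rcons.
rewrite -(sorted_pairwise ltn_trans) => /andP[J'i J's].
have J'N : all (gtn N) J'.
  by apply: sub_all J'i => j /= ji; exact: leq_trans iN.
have [iN'|Ni] := ltnP i N.
  by rewrite mapa ?all_rcons ?J'N /= ?iN'//; apply: aJ; rewrite // all_rcons /= iN'.
rewrite map_rcons mapa// ltnNge Ni /= size_rcons.
rewrite size_rcons in Jn.
rewrite (xJ J'); first by apply: aJ => //; exact: ltnW.
exists (size J') => //; split=> // j /(allP J'N).
exact.
Qed.

End Ramsey.

(** * Consequences of oligomorphy *)
Lemma card_seq (T : choiceType) (s : seq T) : [set` s] #= `I_(size (undup s)).
Proof.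
have -> : [set` s] = [set` [fset x in s]%fset].
  by rewrite eqEsubset; split=> x /=; rewrite !inE.
apply/card_eq_fsetP; rewrite card_fseq.
by apply: perm_size; apply: uniq_perm; rewrite ?undup_uniq.
Qed.

Section Oligomorphic.
Context {I : Type} {ar : I -> nat} {R : structure ar}.
Hypothesis oligo : oligomorphic (Aut R).

Lemma orbit_representatives q : exists Xs : set (set R),
  [/\ finite_set Xs, forall X, Xs X -> X #= `I_q &
      forall X : set R, X #= `I_q -> exists2 g, Aut R g & Xs (g @` X)].
Proof.
pose orb (X : set R) : set (set R) := [set g @` X | g in Aut R].
have orb_id X : orb X X by exists id; [by split=> //; exists id|exact: image_id].
have /choice[rep repP] : forall O : set (set R), exists X : set R,
    (orb @` [set X | X #= `I_q]) O -> X #= `I_q /\ orb X = O.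
  move=> O; have [[X Xq XO]|nO] := pselect ((orb @` [set X | X #= `I_q]) O).
    by exists X.
  by exists set0 => /nO.
exists (rep @` (orb @` [set X | X #= `I_q])); split.
- exact/finite_image/oligo.
- by move=> _ [O OD <-]; have [] := repP O OD.
- move=> X Xq; have OD : (orb @` [set X | X #= `I_q]) (orb X) by exists X.
  have [_ repX] := repP _ OD; have := orb_id (rep (orb X)).
  by rewrite repX => -[g gA gX]; exists g => //; rewrite gX; exists (orb X).
Qed.

(** The form in which oligomorphy is used to bound numbers: a finite-valued
    invariant of q-element sets takes finitely many values altogether. *)
Lemma oligomorphic_finite_invariant q (phi : set R -> set nat) :
  (forall X g n, Aut R g -> phi X n -> phi (g @` X) n) ->
  (forall X, X #= `I_q -> finite_set (phi X)) ->
  finite_set [set n | exists2 X, X #= `I_q & phi X n].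
Proof.
move=> phiA phif; have [Xs [Xsf Xsq XsA]] := orbit_representatives q.
apply: (@sub_finite_set _ _ (\bigcup_(X in Xs) phi X)).
  move=> n [X Xq Xn]; have [g gA gX] := XsA X Xq.
  by exists (g @` X) => //; exact: phiA.
by apply: bigcup_finite => // X /Xsq /phif.
Qed.

(** Tuples of a given length can all be moved into one finite set Z, hence
    they fall into finitely many orbits: those of tuples of elements of Z. *)
Lemma oligomorphic_seq m : exists2 Z : set R, finite_set Z &
  forall s : seq {classic R}, size s = m ->
    exists2 g, Aut R g & forall x, x \in s -> Z (g x).
Proof.
have /choice[Xs XsP] := orbit_representatives.
exists (\bigcup_(k in `I_m.+1) \bigcup_(X in Xs k) X).
  apply: bigcup_finite => // k _; have [? Xk _] := XsP k.
  by apply: bigcup_finite => // X /Xk ?; apply/finite_setP; exists k.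
move=> s sm; have [_ _ XA] := XsP (size (undup s)).
have [g gA gX] := XA _ (card_seq s); exists g => // x xs.
exists (size (undup s)); first by rewrite /= ltnS -sm size_undup.
by exists (g @` [set` s]) => //; exists x.
Qed.

(** The colour of a tuple is its image, together with that of D, in the finite
    set given by [oligomorphic_seq].  Two tuples of the same colour are then
    exchanged by an automorphism that fixes D pointwise. *)
Lemma indiscernible_tuples (D A : set R) n N : finite_set D -> infinite_set A ->
  exists a : nat -> R,
    [/\ forall i, i < N -> A (a i),
        forall i j, i < N -> j < N -> a i = a j -> i = j &
        forall J J' : seq nat, size J = n -> size J' = n ->
          sorted ltn J -> sorted ltn J' -> all (gtn N) J -> all (gtn N) J' ->
          exists g, [/\ Aut R g, forall x, D x -> g x = x &
                        map (g \o a) J = map a J']].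
Proof.
move=> /(@finite_seqP {classic R})[ds Dds] Ainf.
have [Z Zf ZA] := oligomorphic_seq (size ds + n).
have /choice[g gP] : forall s : seq {classic R}, exists g, size s = n ->
    Aut R g /\ forall x, x \in ds ++ s -> Z (g x).
  move=> s; have [sn|sn] := pselect (size s = n); last by exists id => /sn.
  have [|g gA gZ] := ZA (ds ++ s); first by rewrite size_cat sn.
  by exists g.
pose c (s : seq {classic R}) : seq {classic R} :=
  @map {classic R} {classic R} (g s) (ds ++ s).
have [|a [aA ai [c0 cc0]]] := @ramsey {classic R} _ A c n N Ainf.
  apply: (sub_finite_set _ (@finite_seqs {classic R} Z (size ds + n) Zf)).
  move=> _ [s [sn _] <-].
  rewrite /= /c; split=> [|_ /mapP[x xs ->]]; first by rewrite size_map size_cat sn.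
  by have [_] := gP s sn; apply.
exists a; split=> // J J' Jn J'n Js J's JN J'N.
have sJ : size (map a J) = n by rewrite size_map.
have sJ' : size (map a J') = n by rewrite size_map.
have [gA _] := gP _ sJ; have [g'A _] := gP _ sJ'.
have [g'' g''A g''K] := aut_inv g'A.
have : c (map a J) = c (map a J') by rewrite !cc0.
rewrite /c !map_cat => /eqP; rewrite eqseq_cat ?size_map// => /andP[/eqP eD /eqP eJ].
exists (g'' \o g (map a J)); split; first exact: aut_comp.
  move=> x; rewrite Dds /= => xds.
  by have /eq_in_map/(_ x xds) -> := eD; rewrite g''K.
have := congr1 (map (g'' : {classic R} -> {classic R})) eJ.
rewrite -!map_comp => ->; apply/eq_map => i /=; exact: g''K.
Qed.

(** Tuples of length at most k are reduced to tuples of length exactly k: a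
    sequence of length 2k is used, whose second half serves to complete short
    tuples. *)
Lemma indiscernible_sequence (D A : set R) k : finite_set D -> infinite_set A ->
  exists a : nat -> R,
    [/\ forall i, i < k -> A (a i),
        forall i j, i < k -> j < k -> a i = a j -> i = j &
        forall J J' : seq nat, size J = size J' ->
          sorted ltn J -> sorted ltn J' -> all (gtn k) J -> all (gtn k) J' ->
          exists g, [/\ Aut R g, forall x, D x -> g x = x &
                        map (g \o a) J = map a J']].
Proof.
move=> Df Ainf; have [a [aA ai aJ]] := indiscernible_tuples k (k + k) Df Ainf.
have lek i : i < k -> i < k + k by move=> ik; apply: leq_trans ik (leq_addr _ _).
exists a; split=> [i /lek/aA//|i j /lek ik /lek jk|J J' JJ' Js J's Jk J'k].
  exact: ai.
have size_le L : sorted ltn L -> all (gtn k) L -> size L <= k.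
  move=> Ls /allP Lk; rewrite -(size_iota 0 k); apply: uniq_leq_size.
    exact: (sorted_uniq ltn_trans ltnn).
  by move=> i /Lk; rewrite mem_iota.
pose ext L := L ++ iota k (k - size L).
have ext_size L : sorted ltn L -> all (gtn k) L -> size (ext L) = k.
  by move=> Ls Lk; rewrite size_cat size_iota subnKC// size_le.
have ext_sorted L : sorted ltn L -> all (gtn k) L -> sorted ltn (ext L).
  move=> Ls Lk; rewrite !(sorted_pairwise ltn_trans) in Ls *.
  rewrite pairwise_cat Ls -(sorted_pairwise ltn_trans) iota_ltn_sorted !andbT.
  apply/allrelP => i j /(allP Lk) /= ik; rewrite mem_iota => /andP[kj _].
  exact: leq_trans kj.
have ext_all L : sorted ltn L -> all (gtn k) L -> all (gtn (k + k)) (ext L).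
  move=> Ls Lk; rewrite all_cat (sub_all _ Lk)//=; apply/allP => i.
  rewrite mem_iota => /andP[_ /leq_trans]; apply.
  by rewrite leq_add2l leq_subr.
have [||||||g [gA gD gJ]] := aJ (ext J) (ext J'); auto.
exists g; split=> //; move: gJ; rewrite !map_cat => /(congr1 (take (size J))).
by rewrite !take_size_cat ?size_map.
Qed.

End Oligomorphic.

(** * An order on the component *)
Lemma card_setU_disjoint (T : Type) (D K : set T) n m :
  D #= `I_n -> K #= `I_m -> (forall x, D x -> ~ K x) -> D `|` K #= `I_(n + m).
Proof.
move=> + Km; elim: n D => [|n IHn] D Dn DK.
  by move: Dn; rewrite II0 card_eq0 => /eqP ->; rewrite set0U.
move: Dn => /eq_cardSP[x Dx Dxn]; rewrite addSn -(setD1K Dx) -setUA.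
apply: card_setU1; first by move=> [[_ /(_ erefl)]//|]; exact: DK.
by apply: IHn => // y [/DK].
Qed.

Lemma finite_injective_onto (T : Type) (D : set T) (f : T -> T) :
  finite_set D -> (forall x, D x -> D (f x)) ->
  (forall x y, D x -> D y -> f x = f y -> x = y) -> D `<=` f @` D.
Proof.
move=> Df fD fi x Dx; apply: contrapT => nfx.
have [m Dm] := (finite_setP (D `\ x)).1 (finite_setD _ Df).
have DSm : D #= `I_m.+1.
  by rewrite -(setD1K Dx); apply: card_setU1 => // -[_ /(_ erefl)].
have fDD : f @` D #= D.
  by apply: inj_card_eq => y z /set_mem Dy /set_mem; exact: fi.
have : f @` D #<= D `\ x.
  apply: subset_card_le => _ [y Dy <-]; split; first exact: fD.
  by move=> fyx; apply: nfx; exists y.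
rewrite (card_le_eql fDD) (card_le_eql DSm) (card_le_eqr Dm) card_le_II.
by rewrite ltnn.
Qed.

Definition strict_order (T : Type) (A : set T) (lt : T -> T -> Prop) : Prop :=
  [/\ forall x, A x -> ~ lt x x,
      forall x y z, A x -> A y -> A z -> lt x y -> lt y z -> lt x z &
      forall x y, A x -> A y -> x <> y -> lt x y \/ lt y x].

Section OrderIndiscernible.
Context {I : Type} {ar : I -> nat} {R : structure ar}.
Implicit Types (A D F K H : set R) (f g : R -> R) (x y z : R).

Definition order_indiscernible F A (lt : R -> R -> Prop) : Prop :=
  forall K f, K `<=` A -> (forall x, K x -> A (f x)) ->
    (forall x, F x -> f x = x) ->
    (forall x y, K x -> K y -> lt x y -> lt (f x) (f y)) ->
    emb (F `|` K) f.

Section Component.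
Variable A : set R.
Hypothesis Ainf : infinite_set A.
Hypothesis Amono : monomorphic_part A.
Hypothesis Aclosed : forall x y, A x -> sim setT x y -> A y.

Let Asim M x y : A x -> A y -> sim M x y.
Proof.
move=> Ax Ay; apply: (@sim_sub _ _ _ setT); first exact: subsetT.
exact: monomorphic_part_sim Amono Ax Ay.
Qed.

Let not_sim M x y : ~ sim M x y -> exists H,
  [/\ finite_set H, H `<=` M, ~ H x, ~ H y & ~ iso (x |` H) (y |` H)].
Proof.
move=> ns; apply: contrapT => nH; apply: ns => H Hf HM Hx Hy.
by apply: contrapT => niso; apply: nH; exists H.
Qed.

(** The elements of F lie outside the class A, so each of them is told apart
    from A by some finite context; D is F together with these contexts. *)
Let separated_from_component F : finite_set F -> F `<=` ~` A ->
  exists D, [/\ finite_set D, F `<=` D, D `<=` ~` A &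
    forall x a, F x -> A a -> ~ sim (D `|` A) x a].
Proof.
move=> Ff FA; have [a0 Aa0] := infinite_setN0 Ainf.
have /choice[H HP] : forall x, exists H, F x ->
    [/\ finite_set H, ~ H x, ~ H a0 & ~ iso (x |` H) (a0 |` H)].
  move=> x; have [Fx|nFx] := pselect (F x); last by exists set0.
  have [|H [Hf _ Hx Ha Hiso]] := @not_sim setT x a0.
    by move=> /sim_sym/(Aclosed Aa0)/(FA x Fx).
  by exists H.
exists (F `|` \bigcup_(x in F) (H x `\` A)); split.
- rewrite finite_setU; split=> //; apply: bigcup_finite => // x /HP[Hf _ _ _].
  exact: finite_setD.
- by move=> x; left.
- by move=> x [/FA//|[y _ []]].
- move=> x a Fx Aa sxa; have [Hf Hx Ha Hiso] := HP x Fx; apply: Hiso.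
  have sxa0 := sim_trans (or_introl (or_introl Fx)) (or_intror Aa0) sxa
    (Asim Aa Aa0).
  apply: sxa0 => // y Hy; have [Ay|nAy] := pselect (A y); first by right.
  by left; right; exists x.
Qed.

(** Among the sets D that separate F from A, one of minimal size separates all
    of its own elements.  Indeed, if d in D were interchangeable with the
    elements of A over D + A, then in every context d could be replaced by a
    fresh element of A, so D - d would still separate F. *)
Let separated_superset F : finite_set F -> F `<=` ~` A ->
  exists D, [/\ finite_set D, F `<=` D, D `<=` ~` A &
    forall x a, D x -> A a -> ~ sim (D `|` A) x a].
Proof.
move=> Ff FA; have [D [/finite_setP[n Dn]]] := separated_from_component Ff FA.
elim: n D Dn => [|n IHn] D Dn FD DA Dsep.
  exists D; split=> //; first by apply/finite_setP; exists 0.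
  by move: Dn; rewrite II0 card_eq0 => /eqP ->.
have [Dsep'|] := pselect (forall x a, D x -> A a -> ~ sim (D `|` A) x a).
  by exists D; split=> //; apply/finite_setP; exists n.+1.
move=> /existsNP[d /existsNP[b /not_implyP[Dd /not_implyP[Ab /contrapT sdb]]]].
have nFd : ~ F d by move=> Fd; apply: Dsep sdb.
apply: (IHn (D `\ d)).
- exact: card_setD1.
- by move=> x Fx; split; [exact: FD|move=> xd; apply: nFd; rewrite -xd].
- by move=> x [/DA].
move=> x a Fx Aa sxa; apply: (Dsep x a Fx Aa) => H Hf HDA Hx Ha.
have [Hd|nHd] := pselect (H d); last first.
  apply: sxa => // y Hy; have [Dy|] := HDA y Hy; last by right.
  by left; split=> // yd; apply: nHd; rewrite -yd.
(* d is replaced in H by an element a' of A, interchangeable with it *)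
have [||a' Aa' na'] := @infinite_avoid _ A (a |` H) => //.
  by rewrite finite_setU; split=> //; exact: finite_set1.
have [a'a nHa'] : a' <> a /\ ~ H a'.
  by split=> ?; apply: na'; [left|right].
have sda' : sim (D `|` A) d a'.
  by apply: sim_trans sdb (Asim Ab Aa'); [left|right].
set K := H `\ d.
have Kf : finite_set K by exact: finite_setD.
have xd : x <> d by move=> xd; apply: nFd; rewrite -xd.
have repl y : (D `|` A) y -> ~ H y -> a' <> y ->
    iso (y |` (d |` K)) (y |` (a' |` K)).
  move=> Dy nHy a'y; rewrite !(setUCA [set y]); apply: sda'.
  - by rewrite finite_setU; split=> //; exact: finite_set1.
  - by move=> z [->//|[/HDA]].
  - move=> [/esym yd|[_ /(_ erefl)]//]; apply: nHy; rewrite yd; exact: Hd.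
  - by move=> [//|[/nHa']].
rewrite -(setD1K Hd).
apply: (iso_trans (repl x _ _ _)) => //; first by left; exact: FD.
  by move=> a'x; apply: (FA x Fx); rewrite -a'x.
apply: iso_trans (iso_sym (repl a _ _ _)) => //; last by right.
apply: sxa.
- by rewrite finite_setU; split=> //; exact: finite_set1.
- move=> z [->|[/HDA[Dz|Az] zd]]; [by right| |by right].
  by left; split.
- move=> [xa'|[/Hx//]]; apply: (FA x Fx); rewrite xa'; exact: Aa'.
- by move=> [/esym//|[/Ha]].
Qed.

Hypothesis oligo : oligomorphic (Aut R).

(** K is enlarged to a finite part K1 of A that contains all separating
    contexts and is larger than D.  An isomorphism phi from D + K1 to D + K0
    then maps D to D.  Since K1 is larger than D, some b of K1 has its image in
    K0; if phi d were in K0 too, it would be interchangeable with phi b, hence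
    d with b, against the separation.  So phi maps K1 onto K0 and the indices
    of the Ramsey sequence K0 can be transported to K1. *)
Lemma finite_indiscernible_order K F :
  finite_set K -> K `<=` A -> finite_set F -> F `<=` ~` A ->
  exists r : R -> nat, (forall x y, K x -> K y -> r x = r y -> x = y) /\
    order_indiscernible F K (fun x y => r x < r y).
Proof.
move=> Kf KA Ff FA; have [D [Df FD DA Dsep]] := separated_superset Ff FA.
have [a0 Aa0] := infinite_setN0 Ainf.
have /choice[H HP] : forall d, exists H, D d ->
    [/\ finite_set H, H `<=` D `|` A, ~ H d, ~ H a0 & ~ iso (d |` H) (a0 |` H)].
  move=> d; have [Dd|nDd] := pselect (D d); last by exists set0.
  by have [H HP] := not_sim (Dsep d a0 Dd Aa0); exists H.
(* E makes K1 larger than D. *)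
have [n Dn] := (finite_setP D).1 Df.
have [E EA En] : exists2 E, finite_set E /\ E `<=` A & ~ (E #<= D).
  have [E EA En] := @infinite_set_fset {classic R} _ n.+1 Ainf.
  exists [set` E]; first by split=> //; exact: (@finite_fset {classic R}).
  have Ecard : [set` E] #= `I_(#|` E|)%fset by exact/card_eq_fsetP.
  rewrite (card_le_eqr Dn) (card_le_eql Ecard) card_le_II.
  by apply/negP; rewrite -ltnNge.
pose K1 := (K `|` E) `|` (a0 |` \bigcup_(d in D) (H d `&` A)).
have K1f : finite_set K1.
  rewrite !finite_setU; split; first by split=> //; case: EA.
  split; first exact: finite_set1.
  by apply: bigcup_finite => // d /HP[Hf _ _ _ _]; exact: finite_setIl.
have K1A : K1 `<=` A.
  by move=> x [[/KA|]//|[->//|[d _ []]//]]; case: EA => _; apply.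
have KK1 : K `<=` K1 by move=> x; left; left.
have [k K1k] := (finite_setP K1).1 K1f.
have [a [aA ai aJ]] := indiscernible_sequence oligo k Df Ainf.
pose K0 := a @` `I_k.
have K0A : K0 `<=` A by move=> _ [i ik <-]; exact: aA.
have K0k : K0 #= `I_k.
  by apply: inj_card_eq => i j /set_mem ik /set_mem; exact: ai.
have DK0 : D `|` K0 #= `I_(n + k).
  by apply: card_setU_disjoint => // x /DA nAx /K0A.
have DK1 : D `|` K1 #= `I_(n + k).
  by apply: card_setU_disjoint => // x /DA nAx /K1A.
have [phi phie phiK] : iso (D `|` K1) (D `|` K0).
  apply: (monomorphic_part_iso Amono).
  - by apply/finite_setP; exists (n + k).
  - by rewrite card_eq_sym in DK1; exact: card_eq_trans DK0 DK1.
  - have K1A0 : K1 `\` A = set0 by rewrite setD_eq0.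
    have K0A0 : K0 `\` A = set0 by rewrite setD_eq0.
    by rewrite (setDUl D K1) (setDUl D K0) K1A0 K0A0.
have [phii phiR] := phie.
have phiDK x : (D `|` K1) x -> (D `|` K0) (phi x).
  by move=> DKx; rewrite -phiK; exists x.
have phiD d : D d -> D (phi d).
  move=> Dd; apply: contrapT => nDpd.
  have K0pd : K0 (phi d) by have [|//|//] := phiDK d; left.
  have [b K1b nDpb] : exists2 b, K1 b & ~ D (phi b).
    apply: contrapT => nb; apply: En.
    have pE : phi @` E #= E.
      apply: inj_card_eq => x y /set_mem Ex /set_mem Ey.
      by apply: phii; right; left; right.
    rewrite -(card_le_eql pE); apply: subset_card_le => _ [x Ex <-].
    apply: contrapT => nDx; apply: nb; exists x => //.
    by left; right.
  have K0pb : K0 (phi b) by have [|//|//] := phiDK b; right.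
  have sdb : sim (D `|` K1) d b.
    apply: (sim_emb phie phiDK); [by left|by right|].
    by apply: Asim; exact: K0A.
  have K1a0 : K1 a0 by right; left.
  have sda0 : sim (D `|` K1) d a0.
    by apply: sim_trans sdb (Asim (K1A b K1b) Aa0); [left|right].
  have [Hf HDA Hd Ha0 Hiso] := HP d Dd; apply: Hiso; apply: sda0 => // x Hx.
  have [Dx|Ax] := HDA x Hx; first by left.
  by right; right; right; exists d.
have phiK1 x : K1 x -> K0 (phi x).
  move=> K1x; have [|Dpx|//] := phiDK x; first by right.
  have [|y Dy pxy] := finite_injective_onto Df phiD _ Dpx.
    by move=> y z Dy Dz; apply: phii; left.
  exfalso; apply: (DA y Dy); rewrite (_ : y = x); first exact: K1A.
  by apply: phii => //; [left|right].
have /choice[r rP] : forall x, exists i, K1 x -> i < k /\ a i = phi x.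
  move=> x; have [/phiK1[i ik aix]|nK1x] := pselect (K1 x); first by exists i.
  by exists 0.
have ri x y : K1 x -> K1 y -> r x = r y -> x = y.
  move=> Kx Ky rxy; apply: phii; [by right|by right|].
  by have [_ <-] := rP x Kx; have [_ <-] := rP y Ky; rewrite rxy.
exists r; split=> [x y /KK1 Kx /KK1 Ky|K' f K'K fK fF fr]; first exact: ri.
have /choice[s sP] : forall i, exists x, (r @` K') i -> K' x /\ r x = i.
  move=> i; have [[x Kx <-]|nK'i] := pselect ((r @` K') i); first by exists x.
  by exists a0 => /nK'i.
have sr x : K' x -> s (r x) = x.
  move=> Kx; have [|K's rs] := sP (r x); first by exists x.
  by apply: ri => //; apply: KK1; exact: K'K.
pose J := [seq i <- iota 0 k | `[< (r @` K') i >]].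
pose J' := [seq r (f (s i)) | i <- J].
have Jin i : i \in J -> exists2 x, K' x & r x = i.
  by rewrite mem_filter => /andP[/asboolP[x]]; exists x.
have Jsort : sorted ltn J.
  by apply: sorted_filter; [exact: ltn_trans|exact: iota_ltn_sorted].
have [|||||g [gA gD gJ]] := aJ J J'.
- by rewrite size_map.
- exact: Jsort.
- rewrite sorted_map.
  apply: (@sub_in_sorted _ (mem J) ltn) Jsort => [_ _ /Jin[x Kx <-] /Jin[y Ky <-]|].
    by rewrite /= !sr//; exact: fr.
  exact/allP.
- by apply/allP => _ /Jin[x Kx <-] /=; have [] := rP x (KK1 x (K'K x Kx)).
- apply/allP => _ /mapP[_ /Jin[x Kx <-] ->] /=; rewrite sr//.
  by have [] := rP (f x) (KK1 _ (fK x Kx)).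
have gphi x : K' x -> g (phi x) = phi (f x).
  move=> Kx; have [rk ar_] := rP x (KK1 x (K'K x Kx)).
  have [_ <-] := rP (f x) (KK1 _ (fK x Kx)).
  have rJ : r x \in J.
    rewrite mem_filter mem_iota; apply/andP; split=> //; apply/asboolP.
    by exists x.
  have gaJ : {in J, g \o a =1 a \o (fun i => r (f (s i)))}.
    by apply/eq_in_map; rewrite gJ /J' -map_comp.
  by have := gaJ _ rJ; rewrite /= ar_ sr.
(* f fixes F only, whereas the automorphism g fixes the larger set D. *)
pose f' x := if pselect (K' x) then f x else x.
have f'K x : K' x -> f' x = f x by rewrite /f'; case: pselect.
have f'D x : D x -> f' x = x.
  move=> Dx; rewrite /f'; case: pselect => // Kx.
  by exfalso; apply: (DA x Dx); apply/KA/K'K.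
apply: (@emb_eq _ _ _ _ f').
  move=> x [Fx|Kx]; last exact: f'K.
  by rewrite f'D; [rewrite fF|exact: FD].
apply: (@emb_sub _ _ _ (D `|` K')); first exact: setSU.
apply: (emb_cancel phie).
  move=> x [Dx|Kx]; first by left; rewrite f'D.
  by right; rewrite f'K//; apply/KK1/fK.
apply: (@emb_eq _ _ _ _ (g \o phi)).
  move=> x [Dx|Kx] /=; first by rewrite f'D// gD//; exact: phiD.
  by rewrite f'K// gphi.
apply: emb_comp (emb_aut setT gA) _ => //.
apply: emb_sub phie => x [Dx|Kx]; first by left.
by right; apply/KK1/K'K.
Qed.

Hypothesis Rcount : countable [set: R].

(** For each n, order the finitely many elements of A of index less than n,
    indiscernibly over the elements outside A of index less than n; a pair of A
    is then ordered as most n order it, for a free ultrafilter on n. *)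
Lemma component_order :
  exists2 lt, strict_order A lt & order_indiscernible (~` A) A lt.
Proof.
have [e ei] : exists e : R -> nat, injective e.
  have /countable_injP[e ei] := Rcount.
  by exists e => x y; apply: ei; exact/mem_set.
have Kfin n : finite_set [set x | e x < n].
  by apply: (@finite_preimage _ _ `I_n e) => // x y _ _; exact: ei.
have /choice[r rP] : forall n, exists r : R -> nat,
    (forall x y, A x -> A y -> e x < n -> e y < n -> r x = r y -> x = y) /\
    order_indiscernible (~` A `&` [set x | e x < n]) (A `&` [set x | e x < n])
      (fun x y => r x < r y).
  move=> n; have [|||| r [ri rind]] := @finite_indiscernible_order
    (A `&` [set x | e x < n]) (~` A `&` [set x | e x < n]).
  - exact: finite_setIr.
  - by move=> x [].
  - exact: finite_setIr.
  - by move=> x [].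
  by exists r; split=> // x y Ax Ay xn yn; apply: ri.
have [U UU Uinf] := free_ultrafilter infinite_nat.
have Ue x : U [set n | e x < n].
  apply: Uinf; apply: sub_finite_set (finite_II (e x).+1) => n [_ /negP].
  by rewrite -leqNgt.
pose lt x y := U [set n | r n x < r n y].
have lt_order : strict_order A lt.
  split.
  - move=> x _; rewrite /lt => /filter_ex[n /=]; by rewrite ltnn.
  - move=> x y z _ _ _ xy yz; apply: filterS (filterI xy yz) => n [/=].
    exact: ltn_trans.
  - move=> x y Ax Ay xy.
    have [?|nxy] := in_ultra_setVsetC [set n | r n x < r n y] UU; first by left.
    right; apply: filterS (filterI nxy (filterI (Ue x) (Ue y))) => n /= [rn [xn yn]].
    move/negP: rn; rewrite -leqNgt leq_eqVlt => /predU1P[ryx|//].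
    by exfalso; apply: xy; have [ri _] := rP n; exact/esym/ri.
exists lt => //.
move=> K f KA fA fF flt; apply: emb_finitary => X Xf XK.
have U1 : U [set n | forall y, (X `|` f @` X) y -> e y < n].
  apply: filter_finite => [|y _]; last exact: Ue.
  by rewrite finite_setU; split=> //; exact: finite_image.
have U2 : U [set n | forall p, (X `*` X) p -> K p.1 -> K p.2 -> lt p.1 p.2 ->
    r n p.1 < r n p.2 /\ r n (f p.1) < r n (f p.2)].
  apply: filter_finite => [|[x y] _ /=]; first exact: finite_setX.
  have [[Kx Ky xy]|nxy] := pselect [/\ K x, K y & lt x y].
    by apply: filterS (filterI xy (flt x y Kx Ky xy)) => n [? ?].
  by apply: filterS filterT => n _ Kx Ky xy; exfalso; apply: nxy.
have [n [eX rX]] := filter_ex (filterI U1 U2); have [ri rind] := rP n.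
apply: (@emb_sub _ _ _ ((~` A `&` [set x | e x < n]) `|` (X `&` K))).
  move=> x Xx; have en := eX x (or_introl Xx).
  by have [nAx|Kx] := XK x Xx; [left|right].
apply: rind => [x [Xx /KA Ax]|x [Xx Kx]|x [/fF//]|x y [Xx Kx] [Xy Ky] xy].
- by split=> //; apply: eX; left.
- by split; [exact: fA|apply: eX; right; exists x].
- have [ltxy|ltyx] : lt x y \/ lt y x.
    have [_ _] := lt_order; apply; [exact: KA|exact: KA|].
    by move=> xy'; move: xy; rewrite xy' ltnn.
  + by have [] := rX (x, y) (conj Xx Xy) Kx Ky ltxy.
  + have [/= yx _] := rX (y, x) (conj Xy Xx) Ky Kx ltyx.
    by move: (ltn_trans xy yx); rewrite ltnn.
Qed.

End Component.
End OrderIndiscernible.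

(** * Finite chains *)
Lemma card_le_setD1 (T : Type) (X : set T) x n :
  X x -> X #<= `I_n.+1 -> X `\ x #<= `I_n.
Proof.
move=> Xx Xn; have Xf : finite_set X by apply/finite_set_leP; exists n.+1.
have [m Xm] := (finite_setP (X `\ x)).1 (finite_setD _ Xf).
have XSm : X #= `I_m.+1.
  by rewrite -(setD1K Xx); apply: card_setU1 => // -[_ /(_ erefl)].
by move: Xn; rewrite (card_le_eql XSm) (card_le_eql Xm) !card_le_II.
Qed.

Section Chains.
Context {T : Type}.
Variables (A : set T) (lt : T -> T -> Prop).
Hypothesis lt_order : strict_order A lt.
Implicit Types (W U : set T).

Lemma strict_irr x : A x -> ~ lt x x.
Proof. by case: lt_order => /(_ x). Qed.

Lemma strict_trans y x z : A x -> A y -> A z -> lt x y -> lt y z -> lt x z.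
Proof. by case: lt_order => _ + _ => /(_ x y z). Qed.

Lemma strict_total x y : A x -> A y -> [\/ x = y, lt x y | lt y x].
Proof.
case: lt_order => _ _ h Ax Ay; have [xy|xy] := pselect (x = y).
  by constructor 1.
by have [] := h x y Ax Ay xy; [constructor 2|constructor 3].
Qed.

Lemma strict_asym x y : A x -> A y -> lt x y -> ~ lt y x.
Proof. by move=> Ax Ay xy yx; apply: (strict_irr Ax); exact: strict_trans yx. Qed.

Definition chain p U : Prop := exists u : nat -> T,
  (forall i, i < p -> U (u i)) /\ forall i j, i < j -> j < p -> lt (u i) (u j).

Lemma chain_sub p q U V : p <= q -> U `<=` V -> chain q U -> chain p V.
Proof.
move=> pq UV [u [uU ult]]; exists u; split=> [i ip|i j ij jp].
  by apply/UV/uU; exact: leq_trans pq.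
by apply: ult => //; exact: leq_trans pq.
Qed.

Lemma finite_max n W : W `<=` A -> W #= `I_n.+1 ->
  exists2 m, W m & forall x, W x -> x <> m -> lt x m.
Proof.
elim: n W => [|n IHn] W WA /eq_cardSP[x Wx Wxn].
  exists x => // y Wy yx; move: Wxn; rewrite II0 card_eq0 => /eqP W0.
  by have : (W `\ x) y; [split|rewrite W0].
have [|m [Wm mx] mmax] := IHn (W `\ x) _ Wxn; first by move=> y [/WA].
have [|xm|mx'] := strict_total (WA x Wx) (WA m Wm); first by move/esym.
  exists m => // y Wy ym; have [->//|yx] := pselect (y = x).
  exact: mmax.
exists x => // y Wy yx; have [->//|ym] := pselect (y = m).
by apply: strict_trans (WA y Wy) (WA m Wm) (WA x Wx) _ mx'; exact: mmax.
Qed.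

Lemma finite_enumeration (x0 : T) n W : W `<=` A -> W #= `I_n ->
  exists u : nat -> T,
    [/\ forall i, i < n -> W (u i),
        forall i j, i < j -> j < n -> lt (u i) (u j) &
        forall x, W x -> exists2 i, i < n & u i = x].
Proof.
elim: n W => [|n IHn] W WA Wn.
  exists (fun=> x0); split=> // x; move: Wn; rewrite II0 card_eq0 => /eqP ->.
  by [].
have [m Wm mmax] := finite_max WA Wn.
have Wmn : W `\ m #= `I_n by exact: card_setD1.
have [|u [uW ult usurj]] := IHn (W `\ m) _ Wmn; first by move=> x [/WA].
exists (fun i => if i < n then u i else m); split=> [i _|i j ij jn|x Wx].
- by case: ifP => // /uW[].
- rewrite (leq_trans ij jn : i < n).
  case: ifP => jn'; first exact: ult.
  by have [] := uW i (leq_trans ij jn); exact: mmax.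
- have [->|xm] := pselect (x = m); first by exists n => //; rewrite ltnn.
  have [//|i ilt <-] := usurj x.
  by exists i; [exact: ltnW|rewrite ilt].
Qed.

Lemma increasing_card n (u : nat -> T) : (forall i, i < n -> A (u i)) ->
  (forall i j, i < j -> j < n -> lt (u i) (u j)) -> u @` `I_n #= `I_n.
Proof.
move=> uA ult; apply: inj_card_eq => i j /set_mem /= ilt /set_mem /= jlt uij.
have [ij|ji|//] := ltngtP i j.
  by have := ult _ _ ij jlt; rewrite uij => /(strict_irr (uA j jlt)).
by have := ult _ _ ji ilt; rewrite uij => /(strict_irr (uA j jlt)).
Qed.

Lemma infinite_chain p U : U `<=` A -> infinite_set U -> chain p U.
Proof.
move=> UA Uinf; have [x0 Ux0] := infinite_setN0 Uinf.
have [W WU pW] := @infinite_set_fset {classic T} U p Uinf.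
have Wn : [set` W] #= `I_(#|` W|)%fset by exact/card_eq_fsetP.
have [|u [uW ult _]] := finite_enumeration x0 _ Wn.
  by move=> x /WU/UA.
by apply: (chain_sub pW WU); exists u.
Qed.

(** The i-th element of W goes to the i-th element of the chain. *)
Lemma finite_embedding p W U : U `<=` A -> chain p U -> W `<=` A -> W #<= `I_p ->
  exists o : T -> T, (forall x, W x -> U (o x)) /\
    forall x y, W x -> W y -> lt x y -> lt (o x) (o y).
Proof.
move=> UA [v [vU vlt]] WA Wp.
have [n Wn] : exists n, W #= `I_n by apply/finite_setP/finite_set_leP; exists p.
have np : n <= p by rewrite -card_le_II -(card_le_eql Wn).
have [u [uW ult usurj]] := finite_enumeration (v 0) WA Wn.
have /choice[r rP] : forall x, exists i, W x -> i < n /\ u i = x.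
  move=> x; have [/usurj[i ilt uix]|nWx] := pselect (W x); first by exists i.
  by exists 0.
exists (v \o r); split=> [x Wx|x y Wx Wy xy] /=.
  by have [rn _] := rP x Wx; apply: vU; exact: leq_trans np.
have [[xn ux] [yn uy]] := (rP x Wx, rP y Wy).
apply: vlt; last exact: leq_trans np.
rewrite ltnNge leq_eqVlt; apply/negP => /predU1P[ryx|ryx].
  by apply: (strict_irr (WA x Wx)); rewrite -{2}ux -ryx uy.
apply: (strict_asym (WA x Wx) (WA y Wy)) => //.
by rewrite -ux -uy; exact: ult.
Qed.

End Chains.

(** * Permuting the elements of the component *)
Lemma if_pselectT (T : Type) (P : Prop) (a b : T) :
  P -> (if pselect P then a else b) = a.
Proof. by case: pselect. Qed.

Lemma if_pselectF (T : Type) (P : Prop) (a b : T) :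
  ~ P -> (if pselect P then a else b) = b.
Proof. by case: pselect. Qed.

Definition relocate (T : Type) (x y z : T) : T := if pselect (z = x) then y else z.

Definition swap (T : Type) (a b z : T) : T :=
  if pselect (z = a) then b else if pselect (z = b) then a else z.

Section MoveSwap.
Context {T : Type}.
Implicit Types a b x y z : T.

Lemma relocate_eq x y : relocate x y x = y.
Proof. by rewrite /relocate; case: pselect. Qed.

Lemma relocate_neq x y z : z <> x -> relocate x y z = z.
Proof. by rewrite /relocate; case: pselect. Qed.

Lemma swapL a b : swap a b a = b.
Proof. by rewrite /swap if_pselectT. Qed.

Lemma swapR a b : swap a b b = a.
Proof.
have [->|ba] := pselect (b = a); first exact: swapL.
by rewrite /swap if_pselectF// if_pselectT.
Qed.

Lemma swapN a b z : z <> a -> z <> b -> swap a b z = z.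
Proof. by move=> za zb; rewrite /swap !if_pselectF. Qed.

Lemma swapK a b : involutive (swap a b).
Proof.
move=> z; have [->|za] := pselect (z = a); first by rewrite swapL swapR.
have [->|zb] := pselect (z = b); first by rewrite swapR swapL.
by rewrite !swapN// swapN.
Qed.

End MoveSwap.

Section Permutations.
Context {I : Type} {ar : I -> nat} {R : structure ar}.
Variables (A : set R) (lt : R -> R -> Prop).
Hypothesis lt_order : strict_order A lt.
Hypothesis indisc : order_indiscernible (~` A) A lt.
Implicit Types (K U V : set R) (f : R -> R).

Let irr x : A x -> ~ lt x x := @strict_irr _ _ _ lt_order x.
Let trans y x z : A x -> A y -> A z -> lt x y -> lt y z -> lt x z :=
  @strict_trans _ _ _ lt_order y x z.
Let total x y : A x -> A y -> [\/ x = y, lt x y | lt y x] :=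
  @strict_total _ _ _ lt_order x y.
Let asym x y : A x -> A y -> lt x y -> ~ lt y x := @strict_asym _ _ _ lt_order x y.

(** The element x passes over z to the place of y, while p elements on each side
    and everything outside A stay fixed.  Which sets U and V are used is
    immaterial, since increasing maps preserve the relations. *)
Definition jump p : Prop := exists x z y U V,
  [/\ A x, A z, A y, lt x z & lt z y] /\
  [/\ U `<=` A, V `<=` A, forall u, U u -> lt u x & forall v, V v -> lt y v] /\
  [/\ chain lt p U, chain lt p V &
      emb (~` A `|` (x |` (z |` (U `|` V)))) (relocate x y)].

(** Place a on x, b on z, the smaller elements of K in U and the greater ones
    in V, and let x jump to y.  The result is also obtained by first exchanging
    a and b and then placing the smaller of them on z and the greater one
    on y. *)
Lemma swap_adjacent_emb p K a b : jump p -> K `<=` A -> K #<= `I_p ->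
  K a -> K b -> lt a b -> (forall c, K c -> ~ (lt a c /\ lt c b)) ->
  emb (~` A `|` K) (swap a b).
Proof.
move=> [x [z [y [U [V [[Ax Az Ay xz zy] [[UA VA Ux Vy] [Uc Vc me]]]]]]]].
move=> KA Kp Ka Kb ab adj.
have [Aa Ab] := (KA a Ka, KA b Kb).
have xy : lt x y by exact: trans xz zy.
pose K1 := [set c | K c /\ lt c a]; pose K2 := [set c | K c /\ lt b c].
have K1A : K1 `<=` A by move=> c [/KA].
have K2A : K2 `<=` A by move=> c [/KA].
have [|o1 [o1U o1lt]] := finite_embedding lt_order UA Uc K1A.
  by apply: card_le_trans Kp; apply: subset_card_le => c [].
have [|o2 [o2V o2lt]] := finite_embedding lt_order VA Vc K2A.
  by apply: card_le_trans Kp; apply: subset_card_le => c [].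
have Ka_or c : K c -> [\/ c = a, c = b, lt c a | lt b c].
  move=> Kc; have [->|ca|ac] := total (KA c Kc) Aa; first by constructor 1.
    by constructor 3.
  have [->|cb|bc] := total (KA c Kc) Ab; first by constructor 2.
    by exfalso; apply: (adj c Kc).
  by constructor 4.
pose o x' y' c := if pselect (c = a) then x' else if pselect (c = b) then y'
  else if pselect (K1 c) then o1 c else if pselect (K2 c) then o2 c else c.
have nba : b <> a by move=> ba; apply: (irr Aa); rewrite -{2}ba.
have oa x' y' : o x' y' a = x' by rewrite /o if_pselectT.
have ob x' y' : o x' y' b = y' by rewrite /o if_pselectF// if_pselectT.
have oK1 x' y' c : K1 c -> o x' y' c = o1 c.
  move=> K1c; have [Kc ca] := K1c.
  rewrite /o [LHS]if_pselectF => [|e]; last by rewrite e in ca; exact: (irr Aa).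
  rewrite [LHS]if_pselectF => [|e]; last by rewrite e in ca; exact: (asym Aa Ab).
  by rewrite if_pselectT.
have oK2 x' y' c : K2 c -> o x' y' c = o2 c.
  move=> K2c; have [Kc bc] := K2c; have Ac := KA c Kc.
  rewrite /o [LHS]if_pselectF => [|e]; last by rewrite e in bc; exact: (asym Aa Ab).
  rewrite [LHS]if_pselectF => [|e]; last by rewrite e in bc; exact: (irr Ab).
  rewrite [LHS]if_pselectF ?if_pselectT// => -[_ ca].
  by apply: (asym Aa Ab ab); exact: trans bc ca.
have oN x' y' c : ~ A c -> o x' y' c = c.
  move=> nAc; rewrite /o [LHS]if_pselectF => [|e]; last by rewrite e in nAc.
  rewrite [LHS]if_pselectF => [|e]; last by rewrite e in nAc.
  by rewrite [LHS]if_pselectF => [|/K1A//]; rewrite [LHS]if_pselectF => [|/K2A].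
have oe x' y' : A x' -> A y' -> lt x' y' -> (forall u, U u -> lt u x') ->
    (forall v, V v -> lt y' v) -> emb (~` A `|` K) (o x' y').
  move=> Ax' Ay' xy' Ux' Vy'.
  have o1A c : K1 c -> A (o1 c) by move=> /o1U/UA.
  have o2A c : K2 c -> A (o2 c) by move=> /o2V/VA.
  apply: indisc => // [c Kc|c nAc|c d Kc Kd cd].
  - have [->|->|ca|bc] := Ka_or c Kc; rewrite ?oa ?ob//.
      by rewrite oK1//; exact: o1A.
    by rewrite oK2//; exact: o2A.
  - exact: oN.
  - have [Ac Ad] := (KA c Kc, KA d Kd).
    have K1U e : K1 e -> lt (o1 e) x' by move=> /o1U/Ux'.
    have K2V e : K2 e -> lt y' (o2 e) by move=> /o2V/Vy'.
    have [ec|ec|ca|bc] := Ka_or c Kc; have [ed|ed|da|bd] := Ka_or d Kd.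
    + by move: cd; rewrite ec ed => /(irr Aa).
    + by rewrite ec ed oa ob.
    + by case: (asym Ad Aa da); rewrite -ec.
    + rewrite ec oa oK2//; apply: trans xy' _ => //; [exact: o2A|exact: K2V].
    + by case: (asym Aa Ab ab); rewrite -ec -ed.
    + by move: cd; rewrite ec ed => /(irr Ab).
    + by case: (asym Ad Ab); [exact: trans da ab|rewrite -ec].
    + by rewrite ec ob oK2//; exact: K2V.
    + by rewrite ed oa oK1//; exact: K1U.
    + rewrite ed ob oK1//; apply: trans xy' => //; [exact: o1A|exact: K1U].
    + by rewrite !oK1//; exact: o1lt.
    + rewrite oK1// oK2//; apply: (@trans x') => //; [exact: o1A|exact: o2A|exact: K1U|].
      by apply: trans xy' _ => //; [exact: o2A|exact: K2V].
    + by case: (asym Ac Ad cd); rewrite ed; exact: trans ab bc.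
    + by case: (asym Ac Ad cd); rewrite ed.
    + case: (asym Ac Ad cd); apply: trans (bc) => //.
      by apply: trans (ab) => //.
    + by rewrite !oK2//; exact: o2lt.
have Uy u : U u -> lt u y by move=> Uu; apply: trans (Ux u Uu) xy => //; exact: UA.
have Uz u : U u -> lt u z by move=> Uu; apply: trans (Ux u Uu) xz => //; exact: UA.
have Vz v : V v -> lt z v by move=> Vv; apply: trans zy (Vy v Vv) => //; exact: VA.
have oxz : emb (~` A `|` K) (o x z) by exact: oe.
have ozy : emb (~` A `|` K) (o z y) by exact: oe.
apply: (emb_cancel ozy).
  move=> c [nAc|Kc].
    by left; rewrite swapN// => ec; apply: nAc; rewrite ec.
  right; have [->|ca] := pselect (c = a); first by rewrite swapL.
  by have [->|cb] := pselect (c = b); [rewrite swapR|rewrite swapN].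
apply: (@emb_eq _ _ _ _ (relocate x y \o o x z)); last first.
  apply: (emb_comp oxz me) => c [nAc|Kc]; first by left; rewrite oN.
  right; have [->|->|ca|bc] := Ka_or c Kc; rewrite ?oa ?ob.
  - by left.
  - by right; left.
  - by right; right; left; rewrite oK1//; exact: o1U.
  - by right; right; right; rewrite oK2//; exact: o2V.
have nx c : A c -> lt c x \/ lt x c -> c <> x.
  by move=> Ac [] cx e; rewrite e in cx; exact: (irr Ax cx).
move=> c [nAc|Kc] /=.
  rewrite oN// swapN => [|e|e]; try by apply: nAc; rewrite e.
  by rewrite oN// relocate_neq// => e; apply: nAc; rewrite e.
have [->|->|ca|bc] := Ka_or c Kc.
- by rewrite swapL oa ob relocate_eq.
- by rewrite swapR oa ob relocate_neq//; apply: nx => //; right.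
- have K1c : K1 c by [].
  rewrite swapN => [|e|e]; last 2 first.
  + by rewrite e in ca; exact: (irr Aa ca).
  + by rewrite e in ca; exact: (asym Aa Ab ab ca).
  rewrite !oK1// relocate_neq//; apply: nx; first by apply/UA/o1U.
  by left; apply/Ux/o1U.
- have K2c : K2 c by [].
  rewrite swapN => [|e|e]; last 2 first.
  + by rewrite e in bc; exact: (asym Aa Ab ab bc).
  + by rewrite e in bc; exact: (irr Ab bc).
  rewrite !oK2// relocate_neq//; apply: nx; first by apply/VA/o2V.
  by right; apply: trans xy (Vy _ (o2V c K2c)) => //; apply/VA/o2V.
Qed.

Let inversions K f : set (R * R) :=
  [set p | [/\ K p.1, K p.2, lt p.1 p.2 & lt (f p.2) (f p.1)]].

(** An inversion whose values have other values of f between them can be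
    replaced by one with fewer values in between. *)
Let adjacent_inversion K f x y :
  finite_set K -> K `<=` A -> (forall x, K x -> A (f x)) ->
  inversions K f (x, y) -> exists x' y', inversions K f (x', y') /\
    forall c, K c -> ~ (lt (f y') (f c) /\ lt (f c) (f x')).
Proof.
move=> Kf KA fA; pose between x y := [set c | K c /\ lt (f y) (f c) /\ lt (f c) (f x)].
have [m mK] : exists m, between x y #<= `I_m.
  by apply/finite_set_leP; apply: sub_finite_set Kf => c [].
elim: m x y mK => [|m IHm] x y mK xyinv.
  exists x, y; split=> // c Kc cxy; move: mK; rewrite II0 card_le0 => /eqP bxy.
  by have : between x y c; [|rewrite bxy].
have [[c bc]|nb] := pselect (between x y !=set0); last first.
  by exists x, y; split=> // c Kc cxy; apply: nb; exists c.
have := card_le_setD1 bc mK; case: bc => [Kc [yc cx]] mK'.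
case: xyinv => /= Kx Ky xy fyx.
have [[Ax Ay] Ac] := (KA x Kx, KA y Ky, KA c Kc).
have [[Afx Afy] Afc] := (fA x Kx, fA y Ky, fA c Kc).
have [e|ltcx|xc] := total Ac Ax; first by rewrite e in cx; case: (irr Afx cx).
- apply: (IHm c y); last by split=> //; exact: trans xy.
  apply: card_le_trans mK'; apply: subset_card_le => d [Kd [yd dc]]; split.
    by split=> //; split=> //; apply: trans cx => //; exact: fA.
  by move=> e; rewrite e in dc; exact: (irr Afc dc).
- apply: (IHm x c); last by split.
  apply: card_le_trans mK'; apply: subset_card_le => d [Kd [cd dx]]; split.
    by split=> //; split=> //; apply: trans cd => //; exact: fA.
  by move=> e; rewrite e in cd; exact: (irr Afc cd).
Qed.

(** Bubble sort: exchanging the two adjacent values of an inversion decreases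
    the number of inversions, and a map without inversion is increasing. *)
Lemma jump_injection_emb K f : (forall p, jump p) -> finite_set K -> K `<=` A ->
  (forall x, K x -> A (f x)) -> (forall x y, K x -> K y -> f x = f y -> x = y) ->
  (forall x, ~ A x -> f x = x) -> emb (~` A `|` K) f.
Proof.
move=> jp Kf KA; have [p Kp] := (finite_set_leP K).1 Kf.
have [m mf] : exists m, inversions K f #<= `I_m.
  apply/finite_set_leP; apply: sub_finite_set (finite_setX Kf Kf).
  by move=> [x y] [].
have no_inversion_emb g : (forall x, K x -> A (g x)) ->
    (forall x y, K x -> K y -> g x = g y -> x = y) ->
    (forall x, ~ A x -> g x = x) -> ~ (inversions K g !=set0) ->
    emb (~` A `|` K) g.
  move=> gA gi gN noinv; apply: indisc => // x y Kx Ky xy.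
  have [e|//|yx] := total (gA x Kx) (gA y Ky).
    by rewrite (gi x y)// in xy; case: (irr (KA y Ky)).
  by exfalso; apply: noinv; exists (x, y).
elim: m f mf => [|m IHm] f mf fA fi fN.
  apply: no_inversion_emb => // -[q].
  by move: mf; rewrite II0 card_le0 => /eqP ->.
have [[[x0 y0] inv0]|noinv] := pselect (inversions K f !=set0); last first.
  exact: no_inversion_emb.
have [x [y [xyinv adj]]] := adjacent_inversion Kf KA fA inv0.
case: (xyinv) => /= Kx Ky xy fyx.
have [Ax Ay] := (KA x Kx, KA y Ky); have [Afx Afy] := (fA x Kx, fA y Ky).
pose s := swap (f y) (f x).
have sA z : A z -> A (s z).
  rewrite /s => Az; have [->|zy] := pselect (z = f y); first by rewrite swapL.
  by have [->|zx] := pselect (z = f x); [rewrite swapR|rewrite swapN].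
have fKA : f @` K `<=` A by move=> _ [c Kc <-]; exact: fA.
have se : emb (~` A `|` f @` K) s.
  apply: (swap_adjacent_emb (jp p)) => //.
  - exact: card_le_trans (card_image_le _ _) Kp.
  - by move=> _ [c Kc <-]; exact: adj.
have sN z : ~ A z -> s z = z.
  by move=> nAz; rewrite /s swapN// => e; apply: nAz; rewrite e.
have si : injective s by exact: can_inj (swapK _ _).
have fse : emb (~` A `|` K) (s \o f).
  apply: IHm => [|c Kc|c d Kc Kd /si|c nAc].
  - have := card_le_setD1 xyinv mf; apply: card_le_trans.
    apply: subset_card_le => -[c d] [/= Kc Kd cd sdc].
    have [Ac Ad] := (KA c Kc, KA d Kd); have [Afc Afd] := (fA c Kc, fA d Kd).
    have nyx : ~ lt (f x) (f y) by exact: asym.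
    have fE u v : K u -> K v -> f u = f v -> u = v by exact: fi.
    have nxd : c = x -> d <> y.
      move=> ec ed; move: sdc; rewrite ec ed /s swapL swapR; exact: nyx.
    split; last by move=> [ec ed]; exact: (nxd ec ed).
    split=> //=; move: sdc.
    have [ecy|ncy] := pselect (c = y); have [edx|ndx] := pselect (d = x).
    + by rewrite ecy edx in cd; case: (asym Ax Ay).
    + rewrite ecy /s swapL; have [edy|ndy] := pselect (d = y).
        by rewrite edy swapL => /(irr Afx).
      rewrite swapN => [dx||]; [|by move/(fi d y Kd Ky)|by move/(fi d x Kd Kx)].
      have [/(fi d y Kd Ky)//|//|yd] := total Afd Afy.
      by exfalso; exact: (adj d Kd).
    + rewrite edx /s swapR; have [ecx|ncx] := pselect (c = x).
        by rewrite ecx swapR => /(irr Afy).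
      rewrite swapN => [yc||]; [|by move/(fi c y Kc Ky)|by move/(fi c x Kc Kx)].
      have [/(fi c x Kc Kx)//|cx|//] := total Afc Afx.
      by exfalso; exact: (adj c Kc).
    + have [ecx|ncx] := pselect (c = x).
        rewrite ecx /s swapR; have ndy := nxd ecx.
        rewrite swapN => [dy||]; [|by move/(fi d y Kd Ky)|by move/(fi d x Kd Kx)].
        exact: trans dy fyx.
      rewrite /s (@swapN _ _ _ (f c)) => [|/(fi c y Kc Ky)//|/(fi c x Kc Kx)//].
      have [edy|ndy] := pselect (d = y).
        by rewrite edy swapL => xc; exact: trans fyx xc.
      by rewrite swapN// => [/(fi d y Kd Ky)|/(fi d x Kd Kx)].
  - exact/sA/fA.
  - exact: fi.
  - by rewrite /= fN// sN.
apply: (emb_cancel se) => // z [nAz|Kz]; first by left; rewrite fN.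
by right; exists z.
Qed.

Lemma not_strongly_indiscernible_no_jump :
  ~ strongly_indiscernible A -> exists p, ~ jump p.
Proof.
move=> nsi; apply: contrapT => nj; apply: nsi => k A0 A1 A0A A1A A0k _ f.
move=> [fA01 fi fA10] fN.
have fA0 x : A0 x -> A1 (f x) by exact: fA01.
have fid x : ~ A x -> f x = x by move=> nAx; apply: fN; exact/mem_set.
have jp p : jump p by apply: contrapT => nj'; apply: nj; exists p.
have A0f : finite_set A0 by apply/finite_setP; exists k.
apply: emb_local_isomorphism.
  rewrite setUC; apply: jump_injection_emb => // [x /fA0/A1A//|x y A0x A0y].
  by apply: fi; exact/mem_set.
rewrite image_setU; congr (_ `|` _).
  by rewrite eqEsubset; split=> // _ [x /fA0 ? <-].
rewrite eqEsubset; split=> [_ [x nAx <-]|x nAx]; first by rewrite fid.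
by exists x => //; exact: fid.
Qed.

End Permutations.

(** * Countable orders embed in dense orders *)
Lemma finite_set_bounded (S : set nat) : finite_set S ->
  exists N, forall n, S n -> n <= N.
Proof.
move=> /finite_seqP[s ->]; exists (\max_(n <- s) n) => n ns.
exact: leq_bigmax_seq.
Qed.

Section FiniteSup.
Context {X : Type}.
Variables (ll : X -> X -> Prop) (D Q : set nat) (P : nat -> nat -> Prop).
Variables (x0 : X) (f : nat -> X).
Hypothesis ll_trans : forall y x z, ll x y -> ll y z -> ll x z.
Hypothesis P_total : forall i j, D i -> D j -> i <> j -> P i j \/ P j i.

(** The greatest value of f on the indices of D below m that satisfy Q, with x0
    as default.  The same lemma gives lower bounds by reversing both orders. *)
Lemma finite_sup m :
  (forall i, i < m -> D i -> ll x0 (f i)) ->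
  (forall i j, i < m -> j < m -> D i -> D j -> P i j -> ll (f i) (f j)) ->
  exists l, (l = x0 \/ exists i, [/\ i < m, D i, Q i & l = f i]) /\
    forall i, i < m -> D i -> Q i -> f i = l \/ ll (f i) l.
Proof.
elim: m => [|m IHm] fx0 fP; first by exists x0; split=> //; left.
have [|i j im jm|l [lE lsup]] := IHm.
- by move=> i im; apply: fx0; exact: ltnW.
- by apply: fP; exact: ltnW.
have keep : ~ (D m /\ Q m) \/ (exists2 i, i < m & [/\ D i, Q i, l = f i & P m i]) ->
    exists l, (l = x0 \/ exists i, [/\ i < m.+1, D i, Q i & l = f i]) /\
      forall i, i < m.+1 -> D i -> Q i -> f i = l \/ ll (f i) l.
  move=> lm; exists l; split.
    case: lE => [->|[i [im Di Qi ->]]]; [by left|right; exists i].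
    by split=> //; exact: ltnW.
  move=> i; rewrite ltnS leq_eqVlt => /predU1P[->|im] Di Qi; last exact: lsup.
  case: lm => [[]//|[j jm [Dj Qj -> Pmj]]]; right; apply: fP => //.
  exact: ltnW.
have [[Dm Qm]|nDQ] := pselect (D m /\ Q m); last by apply: keep; left.
have step : ll l (f m) ->
    exists l, (l = x0 \/ exists i, [/\ i < m.+1, D i, Q i & l = f i]) /\
      forall i, i < m.+1 -> D i -> Q i -> f i = l \/ ll (f i) l.
  move=> lm; exists (f m); split; first by right; exists m.
  move=> i; rewrite ltnS leq_eqVlt => /predU1P[->|im] Di Qi; first by left.
  right; have [->//|il] := lsup i im Di Qi.
  exact: ll_trans lm.
case: lE => [lx0|[i [im Di Qi lfi]]]; first by apply: step; rewrite lx0; exact: fx0.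
have [|Pim|Pmi] := @P_total i m Di Dm; first by move=> e; rewrite e ltnn in im.
- by apply: step; rewrite lfi; apply: fP => //; exact: ltnW.
- by apply: keep; right; exists i.
Qed.

End FiniteSup.

(** The target carries a dense transitive relation that need not be linear, so
    that the result applies to the relation of being infinitely far apart in a
    linear order. *)
Section CountableOrder.
Context {X : Type}.
Variable ll : X -> X -> Prop.
Hypothesis ll_trans : forall y x z, ll x y -> ll y z -> ll x z.
Hypothesis ll_dense : forall x y, ll x y -> exists2 z, ll x z & ll z y.
Variables (x0 y0 : X).
Hypothesis ll_ends : ll x0 y0.

Section Numbers.
Variables (D : set nat) (P : nat -> nat -> Prop).
Hypothesis P_order : strict_order D P.

Let inv (s : seq X) : Prop :=
  (forall i, i < size s -> D i -> ll x0 (nth x0 s i) /\ ll (nth x0 s i) y0) /\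
  forall i j, i < size s -> j < size s -> D i -> D j -> P i j ->
    ll (nth x0 s i) (nth x0 s j).

(** The new element is placed between the greatest of the values that must lie
    below it and the least of those that must lie above it; x0 and y0 are used
    when there is none. *)
Let inv_step s : inv s -> exists v, inv (rcons s v).
Proof.
move=> [sends sP]; have Ptot i j : D i -> D j -> i <> j -> P i j \/ P j i.
  by case: P_order => _ _; apply.
suff [v vP] : exists v, D (size s) -> [/\ ll x0 v, ll v y0 &
    forall i, i < size s -> D i ->
      (P i (size s) -> ll (nth x0 s i) v) /\ (P (size s) i -> ll v (nth x0 s i))].
  exists v; split=> [i|i j]; rewrite !size_rcons !ltnS !nth_rcons.
    rewrite leq_eqVlt => /predU1P[-> /vP[]|im Di]; first by rewrite ltnn eqxx.
    by rewrite im; exact: sends.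
  rewrite leq_eqVlt => /predU1P[->|im]; rewrite leq_eqVlt => /predU1P[->|jm].
  - by move=> Dm _; case: P_order => /(_ _ Dm) h _ _ /h.
  - rewrite ltnn eqxx jm => Dm Dj Pmj; have [_ _ vs] := vP Dm.
    by have [_] := vs j jm Dj; apply.
  - rewrite ltnn eqxx im => Di Dm Pim; have [_ _ vs] := vP Dm.
    by have [+ _] := vs i im Di; apply.
  - by rewrite im jm; exact: sP.
have [Dm|nDm] := pselect (D (size s)); last by exists x0 => /nDm.
have [||l [lE lsup]] := @finite_sup _ ll D (P ^~ (size s)) P x0 (nth x0 s)
  ll_trans Ptot (size s).
- by move=> i im Di; have [] := sends i im Di.
- exact: sP.
have [||||u [uE uinf]] := @finite_sup _ (fun x y => ll y x) D (P (size s))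
  (fun i j => P j i) y0 (nth x0 s) _ _ (size s).
- by move=> y x z yx zy; exact: ll_trans yx.
- by move=> i j Di Dj ij; have [] := Ptot i j Di Dj ij; [right|left].
- by move=> i im Di; have [] := sends i im Di.
- by move=> i j im jm Di Dj; exact: sP.
have lu : ll l u.
  case: lE => [->|[i [im Di Pim ->]]]; case: uE => [->//|[j [jm Dj Pmj ->]]].
  - by have [] := sends j jm Dj.
  - by have [] := sends i im Di.
  - by apply: sP => //; case: P_order => _ /(_ i (size s) j Di Dm Dj Pim Pmj).
have x0l : l = x0 \/ ll x0 l.
  case: lE => [->|[i [im Di _ ->]]]; first by left.
  by right; have [] := sends i im Di.
have uy0 : u = y0 \/ ll u y0.
  case: uE => [->|[i [im Di _ ->]]]; first by left.
  by right; have [] := sends i im Di.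
have [v lv vu] := ll_dense lu; exists v => _; split.
- by case: x0l => [<-//|x0l]; exact: ll_trans lv.
- by case: uy0 => [<-//|uy0]; exact: ll_trans uy0.
- move=> i im Di; split=> [Pim|Pmi].
    by have [->//|il] := lsup i im Di Pim; exact: ll_trans lv.
  by have [->//|iu] := uinf i im Di Pmi; exact: ll_trans iu.
Qed.

Lemma numbered_order_embedding : exists h : nat -> X,
  (forall i, D i -> ll x0 (h i)) /\
  forall i j, D i -> D j -> P i j -> ll (h i) (h j).
Proof.
have /choice[F FP] : forall s, exists v, inv s -> inv (rcons s v).
  move=> s; have [/inv_step[v vP]|ninv] := pselect (inv s); first by exists v.
  by exists x0 => /ninv.
pose S := fix S n := if n is m.+1 then rcons (S m) (F (S m)) else [::].
have sS n : size (S n) = n by elim: n => //= n IHn; rewrite size_rcons IHn.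
have SS n : S n.+1 = rcons (S n) (F (S n)) by [].
have nS i m : nth x0 (S (i.+1 + m)) i = nth x0 (S i.+1) i.
  by elim: m => [|m IHm]; rewrite ?addn0// addnS SS nth_rcons sS ltn_addr.
have invS n : inv (S n) by elim: n => [|n IHn]; [split|exact: FP].
exists (fun i => nth x0 (S i.+1) i); split=> [i Di|i j Di Dj Pij].
  by have [/(_ i)[] //] := invS i.+1; rewrite sS.
rewrite -(nS i j) -(nS j i) addSnnS -[j.+1 + i]addnC.
have [_] := invS (i + j.+1); apply => //; rewrite sS.
  by rewrite addnS ltnS leq_addr.
by rewrite ltn_addl.
Qed.

End Numbers.

Lemma countable_order_embedding (Y : Type) (B : set Y) (prec : Y -> Y -> Prop) :
  countable B -> strict_order B prec ->
  exists h : Y -> X, (forall x, B x -> ll x0 (h x)) /\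
    forall x y, B x -> B y -> prec x y -> ll (h x) (h y).
Proof.
move=> /countable_injP[e einj] [pirr ptr ptot].
have ei x y : B x -> B y -> e x = e y -> x = y.
  by move=> Bx By; apply: einj; exact/mem_set.
have [|h [hx0 hP]] := @numbered_order_embedding (e @` B)
    (fun i j => exists x y, [/\ B x, B y, e x = i, e y = j & prec x y]).
  split.
  - move=> _ [x Bx <-] [y [z [By Bz yx zx]]].
    by rewrite (ei y x)// (ei z x)//; exact: pirr.
  - move=> i j k _ _ _ [x [y [Bx By ex ey xy]]] [y' [z [By' Bz ey' ez yz]]].
    exists x, z; split=> //; apply: (ptr x y z) => //.
    by rewrite (ei y y')// ey ey'.
  - move=> _ _ [x Bx <-] [y By <-] exy.
    have [|xy|yx] := ptot x y Bx By; first by move=> xy; apply: exy; rewrite xy.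
      by left; exists x, y.
    by right; exists y, x.
exists (h \o e); split=> [x Bx|x y Bx By xy]; first by apply: hx0; exists x.
apply: hP; [by exists x|by exists y|].
by exists x, y.
Qed.

End CountableOrder.

(** * Bounded finite intervals and density of the component *)
Section Removal.
Context {I : Type} {ar : I -> nat} {R : structure ar}.
Implicit Types (M N F W : set R) (f g : R -> R) (x y z : R).

(** Once F is removed, y can take the place of x.  The set F is required to
    consist of elements interchangeable with x: this keeps the removals inside
    the component of x, so they cannot destroy the elements outside A which
    tell its elements apart. *)
Definition removes M F x y : Prop :=
  [/\ forall z, F z -> M z /\ sim M x z, ~ F x, ~ F y &
      emb (M `\` (y |` F)) (relocate x y)].

Lemma removes_sym M F x y : M x -> M y -> sim M x y ->
  removes M F x y -> removes M F y x.
Proof.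
move=> Mx My sxy [FM nFx nFy me]; split=> //.
  move=> z Fz; have [Mz sxz] := FM z Fz; split=> //.
  exact: sim_trans (sim_sym sxy) sxz.
have [->|xy] := pselect (x = y).
  apply: (@emb_eq _ _ _ _ id); last exact: emb_id.
  move=> z _; have [->|zy] := pselect (z = y); first by rewrite relocate_eq.
  by rewrite relocate_neq.
apply: (emb_cancel me) => [z [Mz nz]|].
  have [->|zy] := pselect (z = y).
    by rewrite relocate_eq; split=> // -[|].
  rewrite relocate_neq//; split=> // -[//|Fz].
  by apply: nz; right.
apply: (@emb_eq _ _ _ _ id); last exact: emb_id.
move=> z [Mz nz] /=; have [->|zy] := pselect (z = y); first by rewrite !relocate_eq.
rewrite (@relocate_neq _ y)// relocate_neq// => zx.
by apply: nz; left.
Qed.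

Lemma removes_image M N F f x y : emb M f -> f @` M = N -> M x -> M y ->
  removes M F x y -> removes N (f @` F) (f x) (f y).
Proof.
move=> fe fMN Mx My [FM nFx nFy me].
have [fi _] := fe; have [g ge gf] := emb_inv fe; rewrite fMN in ge.
have gNM w : N w -> M (g w) by rewrite -fMN => -[z Mz <-]; rewrite gf.
have FM' z : F z -> M z by move=> /FM[].
split.
- move=> _ [z Fz <-]; have [Mz sxz] := FM z Fz.
  split; first by rewrite -fMN; exists z.
  by apply: (sim_emb ge gNM); rewrite ?gf// -fMN; [exists x|exists z].
- by move=> [z Fz e]; apply: nFx; rewrite -(fi z x)//; exact: FM'.
- by move=> [z Fz e]; apply: nFy; rewrite -(fi z y)//; exact: FM'.
have NE w : (N `\` (f y |` f @` F)) w ->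
    exists2 z, (M `\` (y |` F)) z & w = f z.
  rewrite -fMN => -[[z Mz <-] nz]; exists z => //; split=> // -[zy|Fz].
    by apply: nz; left; rewrite zy.
  by apply: nz; right; exists z.
apply: (@emb_eq _ _ _ _ (f \o (relocate x y \o g))).
  move=> _ /NE[z [Mz nz] ->] /=; rewrite gf//.
  have [->|zx] := pselect (z = x); first by rewrite !relocate_eq.
  rewrite !relocate_neq// => e; apply: zx; exact: fi.
apply: (emb_comp (N := M)) fe _; last first.
  move=> _ /NE[z [Mz nz] ->] /=; rewrite gf//.
  by have [->|zx] := pselect (z = x); [rewrite relocate_eq|rewrite relocate_neq].
apply: emb_comp me _; last by move=> _ /NE[z [Mz nz] ->]; rewrite gf.
by apply: emb_sub ge => w [].
Qed.

Definition removal_sizes W : set nat :=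
  [set n | exists x y, [/\ W x, W y,
     exists F, [/\ F #= `I_n, F `<=` ~` W & removes setT F x y] &
     forall m F, F #= `I_m -> F `<=` ~` W -> removes setT F x y -> n <= m]].

Lemma removal_sizes_finite W : finite_set W -> finite_set (removal_sizes W).
Proof.
move=> Wf; pose S (p : R * R) := [set n |
  (exists F, [/\ F #= `I_n, F `<=` ~` W & removes setT F p.1 p.2]) /\
  forall m F, F #= `I_m -> F `<=` ~` W -> removes setT F p.1 p.2 -> n <= m].
apply: (@sub_finite_set _ _ (\bigcup_(p in W `*` W) S p)).
  by move=> n [x [y [Wx Wy xyn nmin]]]; exists (x, y).
apply: bigcup_finite => [|p _]; first exact: finite_setX.
have [[n [[F [Fn FW Fr]] nmin]]|nS] := pselect (S p !=set0); last first.
  by apply: sub_finite_set (finite_set0 _) => n Sn; apply: nS; exists n.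
apply: sub_finite_set (finite_set1 n) => m [[F' [F'm F'W F'r]] mmin].
by apply/eqP; rewrite eqn_leq (nmin m F')//= (mmin n F).
Qed.

Lemma removal_sizes_aut W g n : Aut R g ->
  removal_sizes W n -> removal_sizes (g @` W) n.
Proof.
move=> gA [x [y [Wx Wy [F [Fn FW Fr]] nmin]]].
have [h hA gh] := aut_inv gA; have ginj := can_inj gh.
have autT k : Aut R k -> k @` setT = setT.
  move=> [[k' kk' k'k] _]; rewrite eqEsubset; split=> // z _.
  by exists (k' z).
exists (g x), (g y); split; [by exists x|by exists y| |].
  exists (g @` F); split.
  - by rewrite (card_eql (inj_card_eq _))// => a b _ _; exact: ginj.
  - move=> _ [z Fz <-] [w Ww /ginj wz].
    by apply: (FW z) => //; rewrite -wz.
  - exact: removes_image (emb_aut _ gA) (autT g gA) _ _ Fr.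
move=> m F' F'm F'W F'r.
have hinj : injective h by case: hA => /bij_inj.
apply: (nmin m (h @` F')).
- by rewrite (card_eql (inj_card_eq _))// => a b _ _; exact: hinj.
- move=> _ [z Fz <-] Whz; apply: (F'W z Fz); exists (h z) => //.
  by apply: hinj; rewrite gh.
- by have := removes_image (emb_aut _ hA) (autT h hA) _ _ F'r; rewrite !gh; apply.
Qed.

Section Intervals.
Variables (A : set R) (lt : R -> R -> Prop).
Hypothesis Amono : monomorphic_part A.
Hypothesis lt_order : strict_order A lt.
Hypothesis indisc : order_indiscernible (~` A) A lt.

Let irr x : A x -> ~ lt x x := @strict_irr _ _ _ lt_order x.
Let trans y x z : A x -> A y -> A z -> lt x y -> lt y z -> lt x z :=
  @strict_trans _ _ _ lt_order y x z.
Let total x y : A x -> A y -> [\/ x = y, lt x y | lt y x] :=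
  @strict_total _ _ _ lt_order x y.
Let asym x y : A x -> A y -> lt x y -> ~ lt y x := @strict_asym _ _ _ lt_order x y.

Definition interval M x y : set R := [set z | [/\ M z, A z, lt x z & lt z y]].

(** When nothing is left between x and y, moving x to y is increasing. *)
Lemma interval_removes M x y : A x -> A y -> lt x y ->
  removes M (interval M x y) x y.
Proof.
move=> Ax Ay xy; split.
- move=> z [Mz Az _ _]; split=> //; apply: (sim_sub (@subsetT _ M)).
  exact: (monomorphic_part_sim Amono).
- by move=> [_ _ /(irr Ax)].
- by move=> [_ _ _ /(irr Ay)].
apply: (@emb_sub _ _ _ (~` A `|` (M `&` A `\` (y |` interval M x y)))).
  by move=> z [Mz nz]; have [Az|nAz] := pselect (A z); [right|left].
apply: indisc => [z [[]]//|z [[Mz Az] _]|z nAz|z w [[Mz Az] nz] [[Mw Aw] nw] zw].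
- by have [->|zx] := pselect (z = x); [rewrite relocate_eq|rewrite relocate_neq].
- by rewrite relocate_neq// => e; apply: nAz; rewrite e.
have [zx|zx] := pselect (z = x); have [wx|wx] := pselect (w = x).
- by move: zw; rewrite zx wx => /(irr Ax).
- rewrite zx in zw *; rewrite relocate_eq relocate_neq//.
  have [yw|//|wy] := total Ay Aw; first by exfalso; apply: nw; left.
  by exfalso; apply: nw; right; split.
- rewrite wx in zw *; rewrite relocate_eq relocate_neq//; exact: trans xy.
- by rewrite !relocate_neq.
Qed.

(** If some z between x and y were not removed, x would jump over it. *)
Lemma removes_no_jump p M F x y z : ~ jump A lt p -> ~` A `<=` M ->
  F `<=` A -> A x -> A y -> interval M x y z -> removes M F x y -> M x -> ~ F z ->
  chain lt p [set u | [/\ M u, A u, lt u x & ~ F u]] ->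
  chain lt p [set v | [/\ M v, A v, lt y v & ~ F v]] -> False.
Proof.
move=> nj AM FA Ax Ay [Mz Az xz zy] [_ nFx nFy me] Mx nFz cU cV; apply: nj.
exists x, z, y, [set u | [/\ M u, A u, lt u x & ~ F u]],
  [set v | [/\ M v, A v, lt y v & ~ F v]].
split=> //; split; first by split=> u [].
split=> //; apply: emb_sub me => u.
have nAy w : A w -> lt w y -> w <> y.
  by move=> Aw wy e; rewrite e in wy; exact: irr Ay wy.
move=> [nAu|[->|[->|[[Mu Au ux nFu]|[Mv Av yv nFv]]]]]; split=> //.
- exact: AM.
- by move=> [e|/FA//]; apply: nAu; rewrite e.
- by move=> [e|//]; apply: nAy e => //; exact: trans xz zy.
- by move=> [e|//]; exact: nAy e.
- by move=> [e|//]; apply: nAy e => //; apply: trans ux _ => //; exact: trans xz zy.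
- by move=> [e|//]; rewrite e in yv; exact: irr Ay yv.
Qed.

Section Density.
Hypothesis Ainf : infinite_set A.
Hypothesis Aclosed : forall x y, A x -> sim setT x y -> A y.
Hypothesis oligo : oligomorphic (Aut R).
Variable p : nat.
Hypothesis no_jump : ~ jump A lt p.

Let below x : set R := [set u | A u /\ lt u x].
Let above x : set R := [set u | A u /\ lt x u].

(** Surround x and y by p elements on each side, which the removed set has to
    avoid.  By the two previous lemmas the size of the interval from x to y is
    then the least size of a removed set, a value of an invariant of sets with
    2p + 2 elements. *)
Lemma finite_intervals_bounded : exists b : nat, forall x y n, A x -> A y ->
  lt x y -> chain lt p (below x) -> chain lt p (above y) ->
  interval setT x y #= `I_n -> n <= b.
Proof.
have [b bP] : exists b, forall n,
    (exists2 W, W #= `I_(p + p).+2 & removal_sizes W n) -> n <= b.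
  apply: finite_set_bounded; apply: (oligomorphic_finite_invariant oligo).
  - by move=> W g n gA; exact: removal_sizes_aut.
  - move=> W Wq; apply: removal_sizes_finite; apply/finite_setP.
    by exists (p + p).+2.
exists b => x y n Ax Ay xy cx cy intn; apply: bP.
have [u [ux ult]] := cx; have [v [vy vlt]] := cy.
pose U := u @` `I_p; pose V := v @` `I_p.
have Ux w : U w -> A w /\ lt w x by move=> [i ip <-]; exact: ux.
have Vy w : V w -> A w /\ lt y w by move=> [i ip <-]; exact: vy.
have Up : U #= `I_p.
  by apply: (increasing_card lt_order) => // i ip; have [] := ux i ip.
have Vp : V #= `I_p.
  by apply: (increasing_card lt_order) => // i ip; have [] := vy i ip.
have UV w : U w -> ~ V w.
  move=> /Ux[Aw wx] /Vy[_ yw]; apply: (asym Ax Ay xy).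
  exact: trans yw wx.
have nUx : ~ U x by move=> /Ux[_ /(irr Ax)].
have nVx : ~ V x by move=> /Vy[_ /(asym Ax Ay xy)].
have nUy : ~ U y by move=> /Ux[_ /(asym Ax Ay xy)].
have nVy : ~ V y by move=> /Vy[_ /(irr Ay)].
exists (x |` (y |` (U `|` V))).
  apply: card_setU1; first by move=> [e|[]//]; rewrite e in xy; exact: irr Ay xy.
  apply: card_setU1; first by move=> [].
  exact: card_setU_disjoint.
exists x, y; split; [by left|by right; left| |].
  exists (interval setT x y); split; [exact: intn| |exact: interval_removes].
  move=> z [_ Az xz zy] [zx|[zy'|[/Ux[_ zx]|/Vy[_ yz]]]].
  - by rewrite zx in xz; exact: irr Ax xz.
  - by rewrite zy' in zy; exact: irr Ay zy.
  - exact: asym Ax Az xz zx.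
  - exact: asym Az Ay zy yz.
move=> m F Fm FW Fr; rewrite -card_le_II -(card_le_eql intn) -(card_le_eqr Fm).
apply: subset_card_le => z zint; apply: contrapT => nFz.
apply: (removes_no_jump no_jump (@subsetT _ _) _ Ax Ay zint Fr _ nFz) => //.
- by move=> w Fw; have [/(_ w Fw)[_ /(Aclosed Ax)]] := Fr.
- exists u; split=> // i ip; have [Au ltu] := ux i ip; split=> // Fu.
  by apply: (FW _ Fu); right; right; left; exists i.
- exists v; split=> // i ip; have [Av ltv] := vy i ip; split=> // Fv.
  by apply: (FW _ Fv); right; right; right; exists i.
Qed.

(** Between two elements that are far apart, that is with an infinite interval
    between them, there is a third one which is far from both: any element with
    more than b elements on both sides inside the interval, where b bounds the
    sizes of finite intervals.  The order of being far apart is thus dense. *)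
Lemma component_contains_countable_orders (Y : Type) (B : set Y)
    (prec : Y -> Y -> Prop) : countable B -> strict_order B prec ->
  exists h : Y -> R, (forall y : Y, B y -> A (h y)) /\
    forall x y : Y, B x -> B y -> prec x y -> lt (h x) (h y).
Proof.
move=> Bc precP; have [b bP] := finite_intervals_bounded.
pose inner x := [/\ A x, chain lt p (below x) & chain lt p (above x)].
pose far x y := [/\ inner x, inner y, lt x y & infinite_set (interval setT x y)].
have long_far x y : inner x -> inner y -> lt x y ->
    chain lt b.+1 (interval setT x y) -> far x y.
  move=> ix iy xy [u [uI ult]]; split=> // /finite_setP[n intn].
  have [[Ax cx _] [Ay _ cy]] := (ix, iy); have := bP x y n Ax Ay xy cx cy intn.
  apply/negP; rewrite -ltnNge -card_le_II -(card_le_eqr intn).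
  have uE : u @` `I_b.+1 #= `I_b.+1.
    by apply: (increasing_card lt_order) => // i /uI[].
  by rewrite -(card_le_eql uE); apply: subset_card_le => _ [i ib <-]; exact: uI.
have below_sub x y : A x -> A y -> lt x y -> below x `<=` below y.
  by move=> Ax Ay xy u [Au ux]; split=> //; exact: trans xy.
have above_sub x y : A x -> A y -> lt x y -> above y `<=` above x.
  by move=> Ax Ay xy u [Au ux]; split=> //; exact: trans ux.
have far_trans y x z : far x y -> far y z -> far x z.
  move=> [ix iy xy infxy] [_ iz yz _].
  have [[[Ax _ _] [Ay _ _]] [Az _ _]] := (ix, iy, iz).
  split=> //; first exact: trans yz.
  apply: sub_infinite_set infxy => w [_ Aw xw wy]; split=> //.
  exact: trans yz.
have far_dense x y : far x y -> exists2 z, far x z & far z y.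
  move=> [ix iy xy infxy]; have [[Ax cx c'x] [Ay cy c'y]] := (ix, iy).
  have intA : interval setT x y `<=` A by move=> z [].
  have [u [uI ult]] := infinite_chain lt_order (b.+1 + b.+1).+1 intA infxy.
  have lt1 i : i < b.+1 -> i < (b.+1 + b.+1).+1.
    by move=> ib; rewrite ltnS (leq_trans (ltnW ib))// leq_addr.
  have lt2 i : i < b.+1 -> (b.+2 + i) < (b.+1 + b.+1).+1.
    by move=> ib; rewrite addSn ltnS ltn_add2l.
  have b1 : b.+1 < (b.+1 + b.+1).+1 by rewrite ltnS leq_addr.
  have [_ Az xz zy] := uI _ b1.
  have iz : inner (u b.+1).
    split=> //; apply: chain_sub (leqnn p) _ _; [|exact: cx| |exact: c'y].
      exact: below_sub.
    exact: above_sub.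
  exists (u b.+1); apply: long_far => //.
  - exists u; split=> [i ib|i j ij jb]; last by apply: ult => //; exact: lt1.
    by have [_ Ai xi _] := uI i (lt1 i ib); split=> //; exact: ult.
  - exists (fun i => u (b.+2 + i)); split=> [i ib|i j ij jb].
      have [_ Ai _ yi] := uI _ (lt2 i ib); split=> //.
      by apply: ult; [rewrite addSn ltnS leq_addr|exact: lt2].
    by apply: ult; [rewrite ltn_add2l|exact: lt2].
have [x0 [y0 far0]] : exists x0 y0, far x0 y0.
  have [u [uA ult]] :=
    infinite_chain lt_order (p + (b.+3 + p)) (@subset_refl _ A) Ainf.
  have lt0 k : k < b.+3 + p -> p + k < p + (b.+3 + p) by rewrite ltn_add2l.
  have ltp i : i < p -> i < p + (b.+3 + p).
    by move=> ip; exact: leq_trans ip (leq_addr _ _).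
  have ltb i : i < b.+3 -> i < b.+3 + p.
    by move=> ib; exact: leq_trans ib (leq_addr _ _).
  have lt1 i j k : i < j -> j < b.+3 + p -> lt (u (p + i)) (u (p + j)).
    by move=> ij jk; apply: ult; [rewrite ltn_add2l|exact: lt0].
  have in0 k : k < b.+3 -> inner (u (p + k)).
    move=> kb; split; first by apply/uA/lt0/ltb.
      exists u; split=> [i ip|i j ij jp]; last by apply: ult => //; exact: ltp.
      split; first by apply/uA/ltp.
      by apply: ult; [exact: leq_trans ip (leq_addr _ _)|exact/lt0/ltb].
    exists (fun i => u (p + (b.+3 + i))); split=> [i ip|i j ij jp].
      split; first by apply/uA/lt0; rewrite ltn_add2l.
      apply: lt1 => //; last by rewrite ltn_add2l.
      exact: leq_trans kb (leq_addr _ _).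
    by apply: lt1; rewrite // ltn_add2l.
  (* p elements below, b + 1 elements in between, p elements above *)
  exists (u (p + 0)), (u (p + b.+2)); apply: long_far; [exact: in0|exact: in0| |].
    exact: lt1 (ltb _ _).
  exists (fun i => u (p + i.+1)); split=> [i ib|i j ij jb].
    have ib3 : i.+1 < b.+3 by rewrite ltnS (leq_trans ib).
    split=> //; [exact/uA/lt0/ltb|exact: lt1 (ltb _ _)|].
    by apply: lt1 => //; exact: ltb.
  by apply: lt1 => //; apply: ltb; rewrite ltnS (leq_trans jb).
have [h [hx0 hP]] := countable_order_embedding far_trans far_dense far0 Bc precP.
exists h; split=> [y /hx0[_ []]//|x y Bx By xy].
by have [] := hP x y Bx By xy.
Qed.

End Density.
End Intervals.
End Removal.

(** * The rationals *)
Section RationalIntervals.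
Import Order.TTheory GRing.Theory Num.Theory.
Local Open Scope ring_scope.

Lemma rat_dense (q q' : rat) : q < q' -> exists2 r, q < r & r < q'.
Proof. by move=> /midf_lt[qr rq']; exists ((q + q') / 2%:R). Qed.

Lemma infinite_rat_interval (q q' : rat) : q < q' ->
  infinite_set [set r : rat | q < r /\ r < q'].
Proof.
move=> qq'; pose g (n : nat) := q + (q' - q) / n.+2%:R.
have d0 : 0 < q' - q by rewrite subr_gt0.
have gi : injective g.
  move=> m n /addrI/(mulfI (lt0r_neq0 d0))/invr_inj/eqP.
  by rewrite eqr_nat => /eqP[].
apply: (@sub_infinite_set _ (range g)).
  move=> _ [n _ <-]; split; first by rewrite ltrDl divr_gt0.
  rewrite -ltrBrDl ltr_pdivrMr// -[ltLHS]mulr1 ltr_pM2l//.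
  by rewrite (ltr_nat rat 1).
have gE : range g #= [set: nat] by apply: inj_card_eq => m n _ _; exact: gi.
by rewrite (eq_finite_set gE); exact: infinite_nat.
Qed.

Definition lex (a b : rat * nat) : Prop := a.1 < b.1 \/ a.1 = b.1 /\ (a.2 < b.2)%N.

Lemma lex_order : strict_order [set: rat * nat] lex.
Proof.
split=> [[q i] _ []|[q i] [q' i'] [q'' i''] _ _ _|[q i] [q' i'] _ _ qi] /=.
- by rewrite ltxx.
- by move=> [_]; rewrite ltnn.
- move=> [/= qq'|[/= -> ii']] [/= q'q''|[/= <- i'i'']].
  + by left; exact: lt_trans q'q''.
  + by left.
  + by left.
  + by right; split=> //; exact: ltn_trans i'i''.
- rewrite /lex /=; have [qq'|qq'|qq'] := ltgtP q q'; [by left; left|by right; left|].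
  have [ii'|ii'|ii'] := ltngtP i i'; [by left; right|by right; right|].
  by exfalso; apply: qi; rewrite qq' ii'.
Qed.

Lemma countable_order_in_rat (Y : Type) (B : set Y) (prec : Y -> Y -> Prop) :
  countable B -> strict_order B prec ->
  exists k : Y -> rat, forall x y, B x -> B y -> prec x y -> k x < k y.
Proof.
move=> Bc precP; have [|||k [_ kP]] := @countable_order_embedding rat
  (fun q q' => q < q') _ _ 0 1 _ _ _ _ Bc precP.
- by move=> y x z; exact: lt_trans.
- by move=> q q' /rat_dense.
- exact: ltr01.
by exists k.
Qed.

End RationalIntervals.

(** * The sizes of adjacency classes, an isomorphism invariant *)
Section Invariant.
Context {I : Type} {ar : I -> nat} {R : structure ar}.
Implicit Types (M N F W : set R) (f g : R -> R) (x y z : R).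

Definition adjacent M x y : Prop :=
  [/\ M y, sim M x y & exists2 F, finite_set F & removes M F x y].

Definition adjacency_sizes M : set nat :=
  [set n | exists2 x, M x & adjacent M x #= `I_n].

Lemma adjacent_refl M x : M x -> adjacent M x x.
Proof.
move=> Mx; split=> //; first exact: sim_refl.
exists set0 => //; split=> //; apply: (@emb_eq _ _ _ _ id); last exact: emb_id.
move=> z _; have [->|zx] := pselect (z = x); first by rewrite relocate_eq.
by rewrite relocate_neq.
Qed.

Lemma adjacent_sym M x y : M x -> adjacent M x y -> adjacent M y x.
Proof.
move=> Mx [My sxy [F Ff Fr]]; split=> //; first exact: sim_sym.
by exists F => //; exact: removes_sym.
Qed.

Lemma adjacent_image M N f x y : emb M f -> f @` M = N -> M x ->
  adjacent M x y -> adjacent N (f x) (f y).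
Proof.
move=> fe fMN Mx [My sxy [F Ff Fr]].
split; first by rewrite -fMN; exists y.
  have [g ge gf] := emb_inv fe; rewrite fMN in ge.
  have gNM w : N w -> M (g w) by rewrite -fMN => -[z Mz <-]; rewrite gf.
  by apply: (sim_emb ge gNM); rewrite ?gf// -fMN; [exists x|exists y].
by exists (f @` F); [exact: finite_image|exact: removes_image fe fMN Mx My Fr].
Qed.

Lemma adjacent_class_image M N f x : emb M f -> f @` M = N -> M x ->
  adjacent N (f x) = f @` adjacent M x.
Proof.
move=> fe fMN Mx; rewrite eqEsubset; split; last first.
  by move=> _ [y xy <-]; exact: adjacent_image fe fMN Mx xy.
have [g ge gf] := emb_inv fe; rewrite fMN in ge.
have gNM : g @` N = M.
  rewrite -fMN eqEsubset; split=> [_ [_ [z Mz <-] <-]|z Mz]; first by rewrite gf.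
  by exists (f z); [exists z|exact: gf].
move=> y xy; have Nfx : N (f x) by rewrite -fMN; exists x.
have := adjacent_image ge gNM Nfx xy; rewrite gf// => xgy.
exists (g y) => //; case: xy => + _ _; rewrite -fMN => -[z Mz <-].
by rewrite gf.
Qed.

Lemma adjacent_class_card M N f x : emb M f -> f @` M = N -> M x ->
  adjacent N (f x) #= adjacent M x.
Proof.
move=> fe fMN Mx; rewrite (adjacent_class_image fe fMN Mx).
apply: inj_card_eq => y z /set_mem[My _ _] /set_mem[Mz _ _].
by case: fe => fi _; exact: fi.
Qed.

Lemma adjacency_sizes_iso M N : iso M N -> adjacency_sizes M = adjacency_sizes N.
Proof.
suff sub M' N' : iso M' N' -> adjacency_sizes M' `<=` adjacency_sizes N'.
  by move=> MN; rewrite eqEsubset; split; apply: sub => //; exact: iso_sym.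
move=> [f fe fMN] n [x Mx xn]; exists (f x); first by rewrite -fMN; exists x.
by rewrite (card_eql (adjacent_class_card fe fMN Mx)).
Qed.

(** The size of the class of x depends on the orbit of x only, and there are
    finitely many orbits of points. *)
Lemma adjacency_sizes_bounded : oligomorphic (Aut R) ->
  exists b, forall n, adjacency_sizes setT n -> n <= b.
Proof.
move=> oligo; apply: finite_set_bounded.
apply: (@sub_finite_set _ _ [set n | exists2 X, X #= `I_1 &
    [set n | exists2 x : R, X x & adjacent setT x #= `I_n] n]).
  move=> n [x _ xn]; exists [set x]; first exact: card_set1.
  by exists x.
apply: (oligomorphic_finite_invariant oligo).
  move=> X g n gA [x Xx xn]; exists (g x); first by exists x.
  have gT : g @` setT = setT.
    case: gA => -[k gk kg] _; rewrite eqEsubset; split=> // z _.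
    by exists (k z).
  by rewrite (card_eql (adjacent_class_card (emb_aut _ gA) gT _)).
move=> X X1.
apply: (@sub_finite_set _ _ (\bigcup_(x in X) [set n | adjacent setT x #= `I_n])).
  by move=> n [x Xx xn]; exists x.
apply: bigcup_finite => [|x _]; first by apply/finite_setP; exists 1.
have [[n xn]|nx] := pselect ([set n | adjacent setT x #= `I_n] !=set0); last first.
  by apply: sub_finite_set (finite_set0 _) => n xn; apply: nx; exists n.
apply: sub_finite_set (finite_set1 n) => m /= xm.
by apply/esym/card_eq_II; rewrite -(card_eql xn).
Qed.

End Invariant.

(** * The siblings *)
Section Siblings.
Context {I : Type} {ar : I -> nat} {R : structure ar}.
Variables (A : set R) (lt : R -> R -> Prop).
Hypothesis Rcount : countable [set: R].
Hypothesis Amono : monomorphic_part A.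
Hypothesis Aclosed : forall x y, A x -> sim setT x y -> A y.
Hypothesis lt_order : strict_order A lt.
Hypothesis indisc : order_indiscernible (~` A) A lt.
Variable p : nat.
Hypothesis no_jump : ~ jump A lt p.
Variable h : rat * nat -> R.
Hypothesis hA : forall a, A (h a).
Hypothesis hlt : forall a b, lex a b -> lt (h a) (h b).
Implicit Types (M N F W : set R) (f g : R -> R) (x y z : R) (a b : rat * nat).

Let h_lt a b : lt (h a) (h b) -> lex a b.
Proof.
move=> hab; have [_ _ ltot] := lex_order.
have [ab|ab] := pselect (a = b).
  by case: (strict_irr lt_order (hA b)); rewrite ab in hab.
have [//|/hlt ba] := ltot a b Logic.I Logic.I ab.
by case: (strict_asym lt_order (hA a) (hA b) hab).
Qed.

Let h_inj : injective h.
Proof.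
move=> a b hab; apply: contrapT => ab; have [_ _ ltot] := lex_order.
have [/hlt|/hlt] := ltot a b Logic.I Logic.I ab; rewrite hab.
  by move/(strict_irr lt_order (hA b)).
by move/(strict_irr lt_order (hA b)).
Qed.

Variable w : rat -> nat.
Hypothesis w_gt0 : forall q, 0 < w q.

(** The fibres of the copy of Q x N in A get prescribed finite sizes, while the
    complement of A is kept whole so that the trace of A remains a class of
    interchangeable elements. *)
Definition thinned : set R := ~` A `|` h @` [set a | a.2 < w a.1].

Let thinned_h a : a.2 < w a.1 -> thinned (h a).
Proof. by move=> aw; right; exists a. Qed.

Let thinnedA x : thinned x -> A x -> exists2 a, a.2 < w a.1 & x = h a.
Proof. by move=> [//|[a aw <-] _]; exists a. Qed.

Let nAthinned : ~` A `<=` thinned.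
Proof. by move=> x; left. Qed.

(** The countable order A is sent increasingly to the points h (q, 0), which
    all belong to the thinned set. *)
Lemma thinned_retraction : exists j : R -> R,
  [/\ emb setT j, forall x, thinned (j x), forall x, ~ A x -> j x = x &
      forall x, A x -> A (j x)].
Proof.
have Ac : countable A by apply: sub_countable Rcount; exact: subset_card_le.
have [k kP] := countable_order_in_rat Ac lt_order.
pose j x := if pselect (A x) then h (k x, 0) else x.
have jA x : A x -> j x = h (k x, 0) by move=> Ax; rewrite /j if_pselectT.
have jN x : ~ A x -> j x = x by move=> nAx; rewrite /j if_pselectF.
exists j; split=> // [|x|x Ax]; last by rewrite jA.
- rewrite -(setUCl A); apply: indisc => // [x Ax|x y Ax Ay xy]; first by rewrite jA.
  by rewrite !jA//; apply: hlt; left; exact: kP.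
- have [Ax|nAx] := pselect (A x); last by left; rewrite jN.
  by rewrite jA//; exact: thinned_h.
Qed.

Let sim_setT M x y : sim setT x y -> sim M x y.
Proof. exact: sim_sub. Qed.

(** The thinned set contains a copy of R by a map j which fixes the elements
    outside A and moves those of A within their class. *)
Let sim_thinned x y : thinned x -> thinned y -> sim thinned x y -> sim setT x y.
Proof.
move=> Mx My sxy; have [j [je jM jN jA]] := thinned_retraction.
have sj z : thinned z -> sim thinned (j z) z.
  move=> Mz; have [Az|nAz] := pselect (A z); last by rewrite jN//; exact: sim_refl.
  by apply/sim_setT/(monomorphic_part_sim Amono) => //; exact: jA.
apply: (sim_emb je (fun z _ => jM z)) => //.
apply: sim_trans (sj x Mx) _ => //.
exact: sim_trans sxy (sim_sym (sj y My)).
Qed.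

Let thinned_closed x y : A x -> thinned x -> thinned y -> sim thinned x y -> A y.
Proof. by move=> Ax Mx My sxy; apply: (Aclosed Ax); exact: sim_thinned. Qed.

(** The retraction j fixes x, y and the removed elements, none of which lie in
    A, and carries contexts in R to contexts in the thinned set. *)
Lemma adjacent_outside x : ~ A x -> adjacent thinned x = adjacent setT x.
Proof.
move=> nAx; have Mx : thinned x by left.
have nA z : sim setT x z -> ~ A z.
  by move=> sxz Az; apply: nAx; apply: Aclosed Az _; exact: sim_sym.
have [j [je jM jN jA]] := thinned_retraction; have [ji _] := je.
rewrite eqEsubset; split=> y [My sxy [F Ff [FM nFx nFy me]]].
  have sxy' := sim_thinned Mx My sxy.
  have FM' z : F z -> sim setT x z.
    by move=> /FM[Mz sxz]; exact: sim_thinned.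
  split=> //; exists F => //; split=> // [z /FM'//|].
  apply: (emb_cancel (N := setT) (g := j)) => //.
  apply: (@emb_eq _ _ _ _ (relocate x y \o j)).
    move=> z _ /=; have [->|zx] := pselect (z = x).
      by rewrite jN// !relocate_eq jN//; exact: nA.
    by rewrite !relocate_neq// => e; apply: zx; apply: ji; rewrite ?e ?jN.
  apply: emb_comp (emb_sub (@subsetT _ _) je) me _ => z [_ nz].
  have [Az|nAz] := pselect (A z); last first.
    by rewrite jN//; split; [left|].
  split=> // -[e|Fjz]; last by apply: (nA _ (FM' _ Fjz)); exact: jA.
  by apply: (nA _ sxy'); rewrite -e; exact: jA.
split; [by left; exact: nA|exact: sim_setT|exists F => //; split=> //].
  by move=> z /FM[_ sxz]; split; [left; exact: nA|exact: sim_setT].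
by apply: emb_sub me => z [].
Qed.

Let between_infinite (q q' : rat) F : (q < q')%R -> finite_set F ->
  infinite_set [set z | [/\ thinned z, A z,
    exists2 r, z = h (r, 0) & (q < r)%R /\ (r < q')%R & ~ F z]].
Proof.
move=> qq' Ff.
have hr : infinite_set ((fun r => h (r, 0)) @` [set r | (q < r)%R /\ (r < q')%R]).
  have e : (fun r => h (r, 0)) @` [set r | (q < r)%R /\ (r < q')%R] #=
      [set r : rat | (q < r)%R /\ (r < q')%R].
    by apply: inj_card_eq => r s _ _ /h_inj[].
  by rewrite (eq_finite_set e); exact: infinite_rat_interval.
apply: sub_infinite_set (infinite_setD hr Ff) => _ [[r qrq' <-] nFr].
by split=> //; [exact: thinned_h|exists r].
Qed.

(** Infinitely many points remain between the two fibres, as well as below the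
    first and above the second, whatever finite set is removed; this is the
    forbidden jump. *)
Let far_not_removed a b F : (a.1 < b.1)%R -> a.2 < w a.1 -> finite_set F ->
  removes thinned F (h a) (h b) -> False.
Proof.
move=> ab aw Ff Fr; have Ma := thinned_h aw.
have [z [Mz Az [r zE [ar_ rb]] nFz]] := infinite_setN0 (between_infinite ab Ff).
have [a1 b1] : (a.1 - 1 < a.1)%R /\ (b.1 < b.1 + 1)%R.
  by rewrite Num.Theory.ltrDl Num.Theory.gtrDl Num.Theory.oppr_lt0.
have zint : interval A lt thinned (h a) (h b) z.
  by split=> //; rewrite zE; apply: hlt; left.
apply: (removes_no_jump lt_order no_jump nAthinned _ (hA a) (hA b) zint Fr) => //.
- by case: Fr => FM _ _ _ u /FM[Mu]; exact: thinned_closed.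
- apply: (infinite_chain lt_order) => [u []//|].
  apply: sub_infinite_set (between_infinite a1 Ff) => u [Mu Au [s uE [_ sa]] nFu].
  by split=> //; rewrite uE; apply: hlt; left.
- apply: (infinite_chain lt_order) => [u []//|].
  apply: sub_infinite_set (between_infinite b1 Ff) => u [Mu Au [s uE [bs _]] nFu].
  by split=> //; rewrite uE; apply: hlt; left.
Qed.

(** The interval inside a fibre is finite and can be removed. *)
Let same_adjacent a b : a.1 = b.1 -> a.2 < b.2 -> b.2 < w b.1 ->
  adjacent thinned (h a) (h b).
Proof.
move=> ab1 ab2 bw; have lab : lt (h a) (h b) by apply: hlt; right.
split; first exact: thinned_h.
  exact/sim_setT/(monomorphic_part_sim Amono).
exists (interval A lt thinned (h a) (h b)); last exact: interval_removes.
apply: (@sub_finite_set _ _ ((fun i => h (a.1, i)) @` `I_(w a.1))).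
  move=> z [Mz Az az zb]; have [[q i] /= iw zE] := thinnedA Mz Az.
  rewrite zE in az zb *; suff aq : a.1 = q by exists i; rewrite /= ?aq.
  have [/= aq|[//]] := h_lt az.
  have [/= qb|[/= ->//]] := h_lt zb.
  by move: (Order.POrderTheory.lt_trans aq qb); rewrite ab1 Order.POrderTheory.ltxx.
exact/finite_image/finite_II.
Qed.

Lemma adjacent_inside a : a.2 < w a.1 ->
  adjacent thinned (h a) = h @` [set b | b.1 = a.1 /\ b.2 < w b.1].
Proof.
move=> aw; have Ma := thinned_h aw.
rewrite eqEsubset; split=> [y ay|_ [b [ba bw] <-]].
  have [My say [F Ff Fr]] := ay.
  have [b bw yE] := thinnedA My (thinned_closed (hA a) Ma My say).
  exists b => //; split=> //; apply: contrapT => nba; rewrite yE in My say Fr.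
  have [ab|ba|//] := Order.TotalTheory.ltgtP a.1 b.1; last by move/esym.
    exact: far_not_removed ab aw Ff Fr.
  exact: far_not_removed ba bw Ff (removes_sym Ma My say Fr).
have [ab2|ba2|ab2] := ltngtP a.2 b.2.
- exact: same_adjacent.
- apply: adjacent_sym; first exact: thinned_h.
  by apply: same_adjacent.
- by rewrite (_ : b = a); [exact: adjacent_refl|case: (a) (b) ba ab2 => ? ? [? ?] /= -> ->].
Qed.

Lemma adjacent_inside_card a : a.2 < w a.1 ->
  adjacent thinned (h a) #= `I_(w a.1).
Proof.
move=> aw; rewrite adjacent_inside//.
have -> : h @` [set b | b.1 = a.1 /\ b.2 < w b.1] = (fun i => h (a.1, i)) @` `I_(w a.1).
  rewrite eqEsubset; split=> [_ [[q i] [/= -> iw] <-]|_ [i iw <-]]; first by exists i.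
  by exists (a.1, i).
by apply: inj_card_eq => i j _ _ /h_inj[].
Qed.

Lemma thinned_sizes n : adjacency_sizes thinned n ->
  @adjacency_sizes _ _ R setT n \/ exists q, n = w q.
Proof.
move=> [x Mx xn]; have [Ax|nAx] := pselect (A x); last first.
  by left; exists x => //; rewrite -adjacent_outside.
right; have [a aw xE] := thinnedA Mx Ax; exists a.1; apply/esym/card_eq_II.
rewrite xE in xn; have := adjacent_inside_card aw.
by rewrite (card_eql xn) card_eq_sym.
Qed.

Lemma thinned_size_width q : adjacency_sizes thinned (w q).
Proof.
exists (h (q, 0)); first exact: thinned_h.
exact: (@adjacent_inside_card (q, 0)).
Qed.

End Siblings.

(** * Counting the siblings *)
Section SiblingClasses.
Context {I : Type} {ar : I -> nat}.
Implicit Types R S T : structure ar.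

Definition isomorphism_class S : set (structure ar) := [set T | isomorphic S T].

Lemma isomorphism_class_eq S T : isomorphic S T ->
  isomorphism_class S = isomorphism_class T.
Proof.
move=> ST; rewrite eqEsubset; split=> V.
  by apply: isomorphic_trans; exact: isomorphic_sym.
exact: isomorphic_trans.
Qed.

Lemma isomorphism_class_inj S T :
  isomorphism_class S = isomorphism_class T -> isomorphic S T.
Proof.
move=> ST; have : isomorphism_class T T by exact: isomorphic_refl.
by rewrite -ST.
Qed.

(** A sibling is isomorphic to the restriction to some subset of R. *)
Lemma sibling_classes_le R : countable [set: R] ->
  sibling_classes R #<= [set: set nat].
Proof.
move=> /countable_injP[e einj].
have sub : sibling_classes R `<=`
    (fun A : set R => isomorphism_class (restriction A)) @` setT.
  by move=> _ [S [[A SA] _] <-]; exists A => //; exact/esym/isomorphism_class_eq.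
apply: card_le_trans (subset_card_le sub) _.
apply: card_le_trans (card_image_le _ _) _.
pose f (A : set R) : set nat := e @` A.
have fE : range f #= [set: set R].
  apply: inj_card_eq => A B _ _ AB.
  have half C D : f C = f D -> C `<=` D.
    move=> CD x Cx; have : (f C) (e x) by exists x.
    by rewrite CD => -[y Dy /(einj _ _ (in_setT _) (in_setT _)) <-].
  by rewrite eqEsubset; split; apply: half.
by rewrite -(card_le_eql fE); exact: subset_card_le.
Qed.

Lemma embeds_restriction R (M : set R) j : emb setT j ->
  (forall x : R, M (j x)) -> embeds R (restriction M).
Proof.
move=> [ji jR] jM; have jM' x : j x \in M by exact/mem_set.
pose f x : restriction M := exist _ (j x) (jM' x).
have fr x : f x \in range f by apply/mem_set; exists x.
exists (range f), (fun x => exist _ (f x) (fr x)); split.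
  apply: inj_surj_bijective => [x y /(congr1 (fun u => sval (sval u))) /= jxy|[u ur]].
    exact: ji jxy.
  by have [x _ fxu] := set_mem ur; exists x; exact: val_inj.
by move=> i t; exact: (jR i t).
Qed.

End SiblingClasses.

Theorem theorem5p4 (I : Type) (ar : I -> nat) (R : structure ar) :
  countable [set: R] ->
  prehomogeneous R ->
  oligomorphic (Aut R) ->
  (exists A : set R,
     [/\ infinite_set A, monomorphic_component A & ~ strongly_indiscernible A]) ->
  sibling_classes R #= [set: set nat].
Proof.
move=> Rcount _ oligo [A [Ainf Acomp nsi]].
have [Amono _] := Acomp.
have Aclosed x y : A x -> sim setT x y -> A y.
  exact: monomorphic_component_sim Ainf Acomp.
have [lt lt_order indisc] := component_order Ainf Amono Aclosed oligo Rcount.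
have [p no_jump] := not_strongly_indiscernible_no_jump lt_order indisc nsi.
have [h [hA hlt]] := component_contains_countable_orders Amono lt_order indisc
  Ainf Aclosed oligo no_jump (countableP [set: rat * nat]) lex_order.
have {}hA a : A (h a) by exact: hA.
have {}hlt a b : lex a b -> lt (h a) (h b) by exact: hlt.
have [b bP] := adjacency_sizes_bounded oligo.
(* The set c is coded by the widths b + 2 + n for n in c; the other fibres
   have width 1.  Adding b + 2 keeps the code clear of the sizes of the classes
   outside A, which are at most b, and of 1. *)
pose w (c : set nat) (q : rat) : nat :=
  if pselect (c `|numq q|%N) then b.+2 + `|numq q|%N else 1.
have w_gt0 c q : 0 < w c q.
  rewrite /w; have [cq|ncq] := pselect (c `|numq q|%N).
    by rewrite if_pselectT.
  by rewrite if_pselectF.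
pose M c := thinned A h (w c).
have Msib c : sibling R (restriction (M c)).
  split; first by exists (M c); exact: isomorphic_refl.
  have [j [je jM _ _]] := thinned_retraction Rcount lt_order indisc hA hlt (w_gt0 c).
  exact: embeds_restriction je jM.
have McE c n : adjacency_sizes (M c) (b.+2 + n) <-> c n.
  split=> [|cn].
    move=> /(thinned_sizes Rcount Amono Aclosed lt_order indisc no_jump hA hlt (w_gt0 c)).
    move=> [/bP|[q]]; first by rewrite addSn ltnNge leqW// leq_addr.
    rewrite /w; have [cq|ncq] := pselect (c `|numq q|%N).
      by rewrite if_pselectT// => /addnI ->.
    by rewrite if_pselectF// addSn => -[].
  have wn : w c n%:~R%R = b.+2 + n by rewrite /w numq_int if_pselectT.
  rewrite -wn.
  exact: (thinned_size_width Rcount Amono Aclosed lt_order indisc no_jump hA hlt (w_gt0 c)).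
apply: Cantor_Bernstein; first exact: sibling_classes_le.
pose cls c := isomorphism_class (restriction (M c)).
have clsE : range cls #= [set: set nat].
  apply: inj_card_eq => c d _ _ /isomorphism_class_inj/restriction_isoP.
  move=> /adjacency_sizes_iso cd; rewrite eqEsubset.
  by split=> n /McE; [rewrite cd|rewrite -cd] => /McE.
rewrite -(card_le_eql clsE); apply: subset_card_le => _ [c _ <-].
by exists (restriction (M c)); [exact: Msib|].
Qed.
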